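(* Let $(R,\mathfrak m,k)$ be a Cohen--Macaulay local ring of dimension $d>0$ with canonical module $\omega_R$. Suppose that there exist an exact sequence of $R$-modules $0\to R\to\omega_R\to C\to0$ with $C\neq0$ and a sequence $x_1,\ldots,x_{d-1}\in\mathfrak m$ that is regular on both $R$ and $C$, such that $C/(x_1,\ldots,x_{d-1})C$ has $k$ as a direct summand. Let $M$ be a finitely generated $R$-module. If there is an integer $n\ge d+2$ such that $$\operatorname{Ext}_R^i(M,R)=0\qquad(n\le i\le n+d-1),$$ then $\operatorname{pd}_R M<\infty$.
   Context: $\operatorname{pd}_R M$ denotes projective dimension. When $d=1$ the sequence $x_1,\ldots,x_{d-1}$ is empty, so the condition says that $C$ itself has $k$ as a direct summand. The hypothesis on $R$ is the paper's definition of ''$R$ satisfies condition $(\ast)$''. *)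

(* Defs.v *)
From HB Require Import structures.
From mathcomp Require Import all_boot all_order all_algebra.
From mathcomp Require Import ring_quotient.
From mathcomp Require Import boolp classical_sets functions.
From mathcomp Require Import finmap.
From mathcomp Require Import monalg.

Set Implicit Arguments.
Unset Strict Implicit.
Unset Printing Implicit Defensive.

Import GRing.Theory.
Local Open Scope ring_scope.
Local Open Scope quotient_scope.

Section Modules.
Variable R : comNzRingType.
Implicit Types U V N : lmodType R.

Section Submod.
Variables (V : lmodType R) (W : submodClosed V).

Record submod := Submod { submod_val :> V; submodP : submod_val \in W }.
HB.instance Definition _ := [isSub for submod_val].
HB.instance Definition _ := [Choice of submod by <:].

Lemma submodule_closed : submod_closed W.
Proof. exact: submodClosedP. Qed.

HB.instance Definition _ :=
  GRing.SubChoice_isSubLmodule.Build R V (mem W) submod submodule_closed.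

End Submod.

Section Quotient.
Variables (V : lmodType R) (W : submodClosed V).

(* A variable W : submodClosed V has no inferred zmodClosed structure, which
   Quotient.quot needs; its membership predicate is given one here. *)
Definition submod_pred : {pred V} := fun x => x \in W.
HB.instance Definition _ :=
  GRing.isSubmodClosed.Build R V submod_pred (submodule_closed W).

Definition quotmod := Quotient.quot submod_pred.
HB.instance Definition _ := GRing.Zmodule.on quotmod.
HB.instance Definition _ := EqQuotient.on quotmod.

Definition scaleq (a : R) : quotmod -> quotmod := lift_op1 quotmod ( *:%R a).

Lemma pi_scale a : {morph \pi_quotmod : x / a *: x >-> scaleq a x}.
Proof.
move=> x; unlock scaleq; apply/eqP.
rewrite -[_ == _]/(_ == _ %[mod Quotient.quot submod_pred]) -Quotient.idealrBE -scalerBr.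
by rewrite rpredZ // Quotient.idealrBE reprK.
Qed.

Lemma pi_add : {morph \pi_quotmod : x y / x + y}.
Proof. by move=> x y; rewrite raddfD. Qed.

Lemma scaleqA a b x : scaleq a (scaleq b x) = scaleq (a * b) x.
Proof. by rewrite -[x]reprK -!pi_scale scalerA. Qed.
Lemma scale1q : left_id 1 scaleq.
Proof. by move=> x; rewrite -[x]reprK -!pi_scale scale1r. Qed.
Lemma scaleqDr : right_distributive scaleq +%R.
Proof.
by move=> a x y; rewrite -[x]reprK -[y]reprK -pi_add -!pi_scale -pi_add scalerDr.
Qed.
Lemma scaleqDl x : {morph scaleq^~ x : a b / a + b}.
Proof.
by move=> a b; rewrite -[x]reprK -!pi_scale -pi_add scalerDl.
Qed.
HB.instance Definition _ :=
  GRing.Zmodule_isLmodule.Build R quotmod scaleqA scale1q scaleqDr scaleqDl.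

Lemma quotmod_eq (x y : V) : \pi_quotmod x = \pi_quotmod y <-> x - y \in W.
Proof.
have E : (x - y \in W) = (x == y %[mod quotmod]).
  exact: (Quotient.idealrBE submod_pred x y).
by rewrite E; split=> /eqP.
Qed.

Lemma pi_linear (a : R) (x y : V) :
  \pi_quotmod (a *: x + y) = a *: \pi_quotmod x + \pi_quotmod y.
Proof. by rewrite pi_add pi_scale. Qed.

End Quotient.

Definition zero_module V := forall v : V, v = 0.

Definition isomorphic U V := exists f : {linear U -> V}, bijective f.

Definition surjective (U V : Type) (f : U -> V) := forall y, exists x, f x = y.

(* Exactness of U -> V -> N at V. *)
Definition exact_at U V N (f : U -> V) (g : V -> N) :=
  forall v, g v = 0 <-> exists u, f u = v.

Definition direct_summand U V :=
  exists N : lmodType R, isomorphic (U * N)%type V.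

Section KernelImage.
Variables (U V : lmodType R) (f : {linear U -> V}).

Definition kermod : {pred U} := fun u => f u == 0.
Fact kermod_closed : submod_closed kermod.
Proof.
split=> [|a u v]; rewrite !unfold_in ?raddf0 // => /eqP fu /eqP fv.
by rewrite linearP fu fv scaler0 addr0.
Qed.
HB.instance Definition _ := GRing.isSubmodClosed.Build R U kermod kermod_closed.

Definition immod : {pred V} := fun v => `[< exists u, f u = v >].
Fact immod_closed : submod_closed immod.
Proof.
split=> [|a u v]; rewrite !unfold_in; first by apply/asboolP; exists 0; rewrite raddf0.
move=> /asboolP[x fx] /asboolP[y fy]; apply/asboolP; exists (a *: x + y).
by rewrite linearP fx fy.
Qed.
HB.instance Definition _ := GRing.isSubmodClosed.Build R V immod immod_closed.

End KernelImage.

(* The quotient Z / (B :&: Z), used with B contained in Z. *)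
Section Subquotient.
Variables (V : lmodType R) (Z B : submodClosed V).

Definition restr_submod : {pred submod Z} := fun z => submod_val z \in B.
Fact restr_submod_closed : submod_closed restr_submod.
Proof.
have [B0 BP] := submodule_closed B.
split=> [|a u v]; rewrite !unfold_in; first exact: B0.
exact: BP.
Qed.
HB.instance Definition _ :=
  GRing.isSubmodClosed.Build R (submod Z) restr_submod restr_submod_closed.

Definition subquotient : lmodType R := quotmod restr_submod.

End Subquotient.

Section HomModule.
Variables (U V : lmodType R).

Definition linear_pred : {pred U -> V} := fun f => `[< linear f >].
Fact linear_pred_closed : submod_closed linear_pred.
Proof.
split=> [|a f g]; rewrite !unfold_in.
  by apply/asboolP => a u v; rewrite /= scaler0 addr0.
move=> /asboolP lf /asboolP lg; apply/asboolP => b u v /=.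
change (a *: f (b *: u + v) + g (b *: u + v)
        = b *: (a *: f u + g u) + (a *: f v + g v)).
rewrite lf lg !scalerDr !scalerA mulrC -!addrA; congr (_ + _).
by rewrite addrCA.
Qed.
HB.instance Definition _ :=
  GRing.isSubmodClosed.Build R (U -> V) linear_pred linear_pred_closed.

Definition Hom : lmodType R := submod linear_pred.

End HomModule.

Section Precomp.
Variables (U V N : lmodType R) (f : {linear U -> V}).

Fact precomp_subproof (h : Hom V N) : submod_val h \o f \in @linear_pred U N.
Proof.
case: h => h /= /asboolP lh; rewrite unfold_in; apply/asboolP => a u v /=.
by rewrite linearP lh.
Qed.

Definition precomp (h : Hom V N) : Hom U N := Submod (precomp_subproof h).
Fact precomp_is_linear : linear precomp.
Proof. by move=> a g h; apply: val_inj. Qed.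
HB.instance Definition _ :=
  GRing.isLinear.Build R (Hom V N) (Hom U N) *:%R precomp precomp_is_linear.

End Precomp.

Definition projective_module (P : lmodType R) :=
  forall (A B : lmodType R) (g : {linear A -> B}) (f : {linear P -> B}),
    surjective g -> exists h : {linear P -> A}, forall x, g (h x) = f x.

Definition injective_module (E : lmodType R) :=
  forall (A B : lmodType R) (g : {linear A -> B}) (f : {linear A -> E}),
    injective g -> exists h : {linear B -> E}, forall x, h (g x) = f x.

Record proj_resolution (M : lmodType R) := ProjResolution {
  pres_mod :> nat -> lmodType R;
  pres_d : forall i, {linear pres_mod i.+1 -> pres_mod i};
  pres_aug : {linear pres_mod 0 -> M};
  pres_proj : forall i, projective_module (pres_mod i);
  pres_aug_surj : surjective pres_aug;
  pres_exact0 : exact_at (pres_d 0) pres_aug;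
  pres_exact : forall i, exact_at (pres_d i.+1) (pres_d i) }.

Record inj_resolution (M : lmodType R) := InjResolution {
  ires_mod :> nat -> lmodType R;
  ires_d : forall i, {linear ires_mod i -> ires_mod i.+1};
  ires_aug : {linear M -> ires_mod 0};
  ires_inj : forall i, injective_module (ires_mod i);
  ires_aug_inj : injective ires_aug;
  ires_exact0 : exact_at ires_aug (ires_d 0);
  ires_exact : forall i, exact_at (ires_d i) (ires_d i.+1) }.

Definition finite_pd M :=
  exists (P : proj_resolution M) (n : nat),
    forall i, (n < i)%N -> zero_module (P i).

Definition finite_injdim M :=
  exists (E : inj_resolution M) (n : nat),
    forall i, (n < i)%N -> zero_module (E i).

Section FreeModule.
Variable V : lmodType R.

(* The free module on the underlying set of V, and its map [v] |-> v to V. *)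
Definition free_mod : lmodType R := {malg R[V]}.

Definition lincomb (U : lmodType R) (h : V -> U) (g : free_mod) : U :=
  \sum_(k <- msupp g) g@_k *: h k.

Lemma lincombEw (U : lmodType R) (h : V -> U) (g : free_mod) (d : {fset V}) :
  (msupp g `<=` d)%fset -> lincomb h g = \sum_(k <- d) g@_k *: h k.
Proof.
move=> le_gd; rewrite /lincomb (big_fset_incl _ le_gd) // => k _ kNg.
by rewrite mcoeff_outdom // scale0r.
Qed.

Fact lincomb_is_linear (U : lmodType R) (h : V -> U) : linear (lincomb h).
Proof.
move=> a g1 g2.
pose d := (msupp g1 `|` msupp g2 `|` msupp (a *: g1 + g2))%fset.
rewrite (@lincombEw _ h (_ + _) d) ?fsubsetUr //.
rewrite (@lincombEw _ h g1 d) ?(@lincombEw _ h g2 d); first last.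
- by rewrite /d -fsetUA fsubsetUl.
- by rewrite /d fsetUAC fsubsetUr.
rewrite scaler_sumr -big_split /=; apply: eq_bigr => k _.
by rewrite mcoeffD mcoeffZ scalerDl scalerA.
Qed.
HB.instance Definition _ (U : lmodType R) (h : V -> U) :=
  GRing.isLinear.Build R free_mod U *:%R (lincomb h) (lincomb_is_linear h).

Lemma lincombU (U : lmodType R) (h : V -> U) v :
  lincomb h (mkmalgU v 1 : free_mod) = h v.
Proof.
rewrite (@lincombEw _ h _ [fset v]%fset) ?msuppU_le //.
by rewrite big_seq_fset1 mcoeffUU scale1r.
Qed.

Lemma free_mod_lincomb (U : lmodType R) (f : {linear free_mod -> U}) (g : free_mod) :
  f g = lincomb (fun v => f (mkmalgU v 1 : free_mod)) g.
Proof.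
rewrite {1}(monalgE g) linear_sum /lincomb; apply: eq_bigr => k _.
have -> : mkmalgU k g@_k = g@_k *: (mkmalgU k 1 : free_mod).
  by apply/malgP => j; rewrite mcoeffZ !mcoeffU mulrnAr mulr1.
by rewrite linearZ_LR.
Qed.

Lemma free_mod_proj : projective_module free_mod.
Proof.
move=> A B g f g_surj.
have [s sP] : {s : V -> A & forall v, g (s v) = f (mkmalgU v 1 : free_mod)}.
  exists (fun v => sval (cid (g_surj (f (mkmalgU v 1 : free_mod))))) => v.
  by case: cid => x.
exists (lincomb s) => x; rewrite (free_mod_lincomb f) /lincomb linear_sum.
by apply: eq_bigr => k _; rewrite linearZ_LR sP.
Qed.

Definition free_aug : {linear free_mod -> V} := lincomb id.

Lemma free_aug_surj : surjective free_aug.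
Proof. by move=> v; exists (mkmalgU v 1 : free_mod); apply: lincombU. Qed.

End FreeModule.

(* P_n is free on the underlying set of the n-th syzygy module. *)
Section StdResolution.
Variable M : lmodType R.

Fixpoint syzygy (n : nat) : lmodType R :=
  if n is n'.+1 then submod (kermod (free_aug (syzygy n'))) else M.

Definition std_mod n : lmodType R := free_mod (syzygy n).

Definition std_d n : {linear std_mod n.+1 -> std_mod n} :=
  (\val : syzygy n.+1 -> std_mod n) \o free_aug (syzygy n.+1).

Lemma std_exact (U : lmodType R) n (f : {linear std_mod n -> U}) :
  (forall x, f x = 0 <-> free_aug (syzygy n) x = 0) -> exact_at (std_d n) f.
Proof.
move=> fP v; rewrite fP; split=> [v0 | [u <-]]; last first.
  exact/eqP/(submodP (free_aug (syzygy n.+1) u)).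
have vK : v \in kermod (free_aug (syzygy n)) by rewrite unfold_in v0.
by have [u uP] := free_aug_surj (Submod vK : syzygy n.+1); exists u; rewrite /= uP.
Qed.

Lemma std_d_eq0 n (x : std_mod n.+1) :
  std_d n x = 0 <-> free_aug (syzygy n.+1) x = 0.
Proof. by split=> [x0 | /= -> //]; apply: val_inj. Qed.

Definition std_resolution : proj_resolution M :=
  @ProjResolution M std_mod std_d (free_aug M)
    (fun i => @free_mod_proj (syzygy i)) (@free_aug_surj M)
    (std_exact (fun=> iff_refl _)) (fun i => std_exact (@std_d_eq0 i)).

End StdResolution.

(* H^i(Hom(P, N)) for a projective resolution P. *)
Section Cohomology.
Variables (M N : lmodType R) (P : proj_resolution M).

Definition Hom_d i : {linear Hom (P i) N -> Hom (P i.+1) N} :=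
  @precomp _ _ N (pres_d P i).

Definition cocycles i : submodClosed (Hom (P i) N) := kermod (Hom_d i).

Definition coboundaries i : submodClosed (Hom (P i) N) :=
  match i with
  | 0 => kermod (@idfun (Hom (P 0) N))  (* the zero submodule *)
  | j.+1 => immod (Hom_d j)
  end.

Definition cohomology i : lmodType R :=
  subquotient (cocycles i) (coboundaries i).

End Cohomology.

(* Up to isomorphism, any projective resolution gives the same module. *)
Definition Ext (i : nat) (M N : lmodType R) : lmodType R :=
  cohomology N (std_resolution M) i.

Definition fin_gen (M : lmodType R) :=
  exists s : seq M, forall v : M, exists c : 'I_(size s) -> R,
    v = \sum_(i < size s) c i *: s`_i.

Section Ideal.
Variable I : idealr R.

Definition ideal_mod : {pred R^o} := fun x => x \in I.
Fact ideal_mod_closed : submod_closed ideal_mod.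
Proof.
split=> [|a x y]; rewrite !unfold_in; first exact: idealr0.
by move=> xI yI; apply: (@rpredD _ I) => //; apply: idealMr.
Qed.
HB.instance Definition _ :=
  GRing.isSubmodClosed.Build R R^o ideal_mod ideal_mod_closed.

Definition residue : lmodType R := quotmod ideal_mod.

Definition maximal_ideal :=
  forall J : idealr R, {subset I <= J} -> J =i I.

End Ideal.

(* The type idealr R contains proper ideals only; the unit ideal is
   generated by 1. *)
Definition noetherian := forall I : idealr R, fin_gen (submod (ideal_mod I)).

Definition noetherian_local (m : idealr R) :=
  [/\ noetherian, maximal_ideal m & forall n, maximal_ideal n -> n =i m].

Definition prime_chain (M : lmodType R) n (p : 'I_n.+1 -> prime_idealr R) :=
  (forall i a, (forall v : M, a *: v = 0) -> a \in p i) /\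
  (forall i j : 'I_n.+1, (i < j)%N ->
     {subset p i <= p j} /\ exists2 x, x \in p j & x \notin p i).

(* dim M = dim (R / Ann M) = d *)
Definition krull_dim (M : lmodType R) (d : nat) :=
  (exists p : 'I_d.+1 -> prime_idealr R, prime_chain M p) /\
  (forall n (p : 'I_n.+1 -> prime_idealr R), prime_chain M p -> (n <= d)%N).

Section RegularSequence.
Variables (xs : seq R) (M : lmodType R).

Definition seq_mod : {pred M} :=
  fun v => `[< exists u : 'I_(size xs) -> M, v = \sum_(i < size xs) xs`_i *: u i >].
Fact seq_mod_closed : submod_closed seq_mod.
Proof.
split=> [|a v w]; rewrite !unfold_in.
  by apply/asboolP; exists (fun=> 0); rewrite big1 // => i _; rewrite scaler0.
move=> /asboolP[u ->] /asboolP[t ->]; apply/asboolP.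
exists (fun i => a *: u i + t i); rewrite scaler_sumr -big_split /=.
by apply: eq_bigr => i _; rewrite scalerDr !scalerA mulrC.
Qed.
HB.instance Definition _ := GRing.isSubmodClosed.Build R M seq_mod seq_mod_closed.

(* M / (xs) M *)
Definition quot_seq : lmodType R := quotmod seq_mod.

End RegularSequence.

Definition regular_seq (M : lmodType R) (xs : seq R) :=
  (forall i, (i < size xs)%N ->
     injective (fun v : quot_seq (take i xs) M => xs`_i *: v)) /\
  ~ zero_module (quot_seq xs M).

Section LocalRing.
Variable m : idealr R.

Definition depth (M : lmodType R) (n : nat) :=
  (exists xs : seq R, [/\ size xs = n, {subset xs <= m} & regular_seq M xs]) /\
  (forall xs : seq R, {subset xs <= m} -> regular_seq M xs -> (size xs <= n)%N).

Definition cohen_macaulay (M : lmodType R) :=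
  fin_gen M /\ exists n, depth M n /\ krull_dim M n.

Definition maximal_cohen_macaulay (M : lmodType R) :=
  cohen_macaulay M /\ exists n, krull_dim M n /\ krull_dim R^o n.

(* dim_k Ext^t(k, M) = r, where t = depth M: this Ext is annihilated by m, so
   its k-structure is determined by the R-structure. *)
Definition has_type (M : lmodType R) (r : nat) :=
  exists2 t, depth M t &
    isomorphic (Ext t (residue m) M) {ffun 'I_r -> residue m}.

(* Bruns and Herzog, Cohen-Macaulay Rings, Definition 3.3.1. *)
Definition canonical_module (omega : lmodType R) :=
  [/\ maximal_cohen_macaulay omega, has_type omega 1 & finite_injdim omega].

Definition cohen_macaulay_local := noetherian_local m /\ cohen_macaulay R^o.

(* d is to be the dimension of R, and omega its canonical module. *)
Definition condition_star (d : nat) (omega : lmodType R) :=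
  exists (C : lmodType R) (f : {linear R^o -> omega}) (g : {linear omega -> C})
         (xs : seq R),
    [/\ [/\ injective f, exact_at f g & surjective g],
        ~ zero_module C,
        size xs = d.-1 /\ {subset xs <= m},
        regular_seq R^o xs /\ regular_seq C xs &
        direct_summand (residue m) (quot_seq xs C)].

End LocalRing.
End Modules.

(* Main.v *)
(** The sequence 0 -> R -> omega -> C -> 0 turns vanishing of Ext(M, R) into
    vanishing of Ext(M, C) one degree lower, as soon as Ext^i(M, omega) = 0 for
    i > d; dividing by x_1, ..., x_(d-1) uses up the d consecutive degrees and
    leaves one degree in which Ext(M, C/xC), hence Ext(M, k), vanishes.  By
    minimal covers this bounds pd M.

    That Ext^i(-, omega) = 0 for i > d on finitely generated modules is shown by
    descending induction on the degree, starting from the finite injective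
    dimension of omega.  If it holds above degree r > d, Nakayama's lemma along
    an omega-regular sequence of length d gives Ext^i(omega, omega) = 0 for
    i > r - d, so Ext^i(C, omega) = 0 there too, so Ext^r(C/xC, omega) = 0, and k
    is a summand of C/xC.  Noetherian induction, with Nakayama again whenever an
    element of the maximal ideal is regular on R/I, passes from k to all R/I. *)

Require Import Defs.
From HB Require Import structures.
From mathcomp Require Import all_boot all_algebra ring_quotient.
From mathcomp Require Import boolp functions.

Set Implicit Arguments.
Unset Strict Implicit.
Unset Printing Implicit Defensive.

Import GRing.Theory.
Local Open Scope ring_scope.

(** * Linear maps and short exact sequences *)

Section LinearMaps.
Variable R : comNzRingType.
Implicit Types U V W X : lmodType R.

Definition mklin U V (f : U -> V) (lf : linear f) : {linear U -> V} :=
  HB.pack f (GRing.isLinear.Build R U V *:%R f lf).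

(** By linearity, single-valuedness of the relation need only be checked at 0. Lifts and
    factorisations are all built this way, so the choice of values is made once. *)
Lemma linear_of_graph U V (G : U -> V -> Prop) :
  (forall u, exists v, G u v) ->
  (forall a u v u' v', G u v -> G u' v' -> G (a *: u + u') (a *: v + v')) ->
  (forall v, G 0 v -> v = 0) ->
  exists f : {linear U -> V}, forall u v, G u v <-> f u = v.
Proof.
move=> Gt Gl G0.
have Gu u v v' : G u v -> G u v' -> v = v'.
  move=> guv guv'; apply/eqP; rewrite -subr_eq0 addrC; apply/eqP/G0.
  by have := Gl (-1) _ _ _ _ guv' guv; rewrite !scaleN1r addNr.
pose f u := sval (cid (Gt u)).
have fP u : G u (f u) by rewrite /f; case: cid.
have lf : linear f by move=> a u v; apply: Gu (fP _) _; apply: Gl; apply: fP.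
exists (mklin lf) => u v /=; split=> [|<-]; last exact: fP.
by move/(Gu _ _ _ (fP u)).
Qed.

Fact pair_lin_subproof U V W (f : {linear U -> V}) (g : {linear U -> W}) :
  linear (fun u => (f u, g u)).
Proof. by move=> a u v; rewrite !linearP. Qed.
Definition pair_lin U V W (f : {linear U -> V}) (g : {linear U -> W}) :
  {linear U -> (V * W)%type} := mklin (pair_lin_subproof f g).

Fact copair_lin_subproof U V W (f : {linear U -> W}) (g : {linear V -> W}) :
  linear (fun u : U * V => f u.1 + g u.2).
Proof. by move=> a u v; rewrite /= !linearP scalerDr addrACA. Qed.
Definition copair_lin U V W (f : {linear U -> W}) (g : {linear V -> W}) :
  {linear (U * V)%type -> W} := mklin (copair_lin_subproof f g).

Fact submod_val_linear V (S : submodClosed V) : linear (@submod_val R V S).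
Proof. by []. Qed.
Definition subincl V (S : submodClosed V) : {linear submod S -> V} :=
  mklin (@submod_val_linear V S).

Fact scale_lin_subproof V (a : R) : linear (fun v : V => a *: v).
Proof. by move=> b u v; rewrite scalerDr !scalerA mulrC. Qed.
Definition scale_lin V (a : R) : {linear V -> V} := mklin (@scale_lin_subproof V a).

Fact quot_lin_subproof V (S : submodClosed V) : linear (fun v => \pi_(quotmod S) v)%qT.
Proof. by move=> a u v; rewrite pi_linear. Qed.
Definition quot_lin V (S : submodClosed V) : {linear V -> quotmod S} :=
  mklin (@quot_lin_subproof V S).

Fact cyc_lin_subproof V (v : V) : linear (fun a : R^o => a *: v).
Proof. by move=> a b c; rewrite scalerDl scalerA. Qed.
Definition cyc_lin V (v : V) : {linear R^o -> V} := mklin (cyc_lin_subproof v).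

Fact hom_of_lin_subproof U V (f : {linear U -> V}) : (f : U -> V) \in @linear_pred R U V.
Proof. by apply/asboolP => a u v; rewrite linearP. Qed.
Definition hom_of_lin U V (f : {linear U -> V}) : Defs.Hom U V := Submod (hom_of_lin_subproof f).

Fact lin_of_hom_subproof U V (h : Defs.Hom U V) : linear (submod_val h).
Proof. exact/asboolP/(submodP h). Qed.
Definition lin_of_hom U V (h : Defs.Hom U V) : {linear U -> V} := mklin (lin_of_hom_subproof h).

Definition ses U V W (i : {linear U -> V}) (p : {linear V -> W}) :=
  [/\ injective i, exact_at i p & surjective p].

Lemma subincl_inj V (S : submodClosed V) : injective (subincl S).
Proof. exact: val_inj. Qed.

Lemma lin_inj U V (f : {linear U -> V}) :
  (forall u, f u = 0 -> u = 0) -> injective f.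
Proof.
move=> f0 u v e; apply/eqP; rewrite -subr_eq0; apply/eqP/f0.
by rewrite linearB e subrr.
Qed.

Lemma kermodP U V (f : {linear U -> V}) u :
  u \in (kermod f : submodClosed U) <-> f u = 0.
Proof. by split=> /eqP. Qed.

Lemma ses_ker U V (p : {linear U -> V}) : surjective p -> ses (subincl (kermod p)) p.
Proof.
split=> //; first exact: subincl_inj.
move=> v; split=> [pv|[[u ku] <-]]; last by apply/eqP.
by exists (Submod (introT eqP pv : v \in kermod p)).
Qed.

Lemma quot_lin_surj V (S : submodClosed V) : surjective (quot_lin S).
Proof. by move=> v; exists (repr v); apply: reprK. Qed.

Lemma quot_lin0 V (S : submodClosed V) v : quot_lin S v = 0 <-> v \in S.
Proof.
have -> : (0 : quotmod S) = quot_lin S 0 by rewrite raddf0.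
by rewrite /= quotmod_eq subr0.
Qed.

Lemma immodP U V (f : {linear U -> V}) v :
  v \in (immod f : submodClosed V) <-> exists u, f u = v.
Proof. by split=> [/asboolP|?]; last exact/asboolP. Qed.

Lemma ses_quot V (S : submodClosed V) : ses (subincl S) (quot_lin S).
Proof.
split; [exact: subincl_inj | | exact: quot_lin_surj].
move=> v; rewrite quot_lin0; split=> [vS|[[u uS] <-] //].
by exists (Submod vS).
Qed.

Lemma ses_coker U V (i : {linear U -> V}) :
  injective i -> ses i (quot_lin (immod i)).
Proof.
by split=> // [v|]; [rewrite quot_lin0 immodP | apply: quot_lin_surj].
Qed.

Lemma isomorphic_bij U V (f : {linear U -> V}) :
  injective f -> surjective f -> isomorphic U V.
Proof.
move=> fi fs; exists f.
have fK y : f (sval (cid (fs y))) = y by case: cid.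
by exists (fun y => sval (cid (fs y))) => [x|y] //; apply: fi.
Qed.

Lemma isomorphic_inv U V : isomorphic U V ->
  exists (f : {linear U -> V}) (g : {linear V -> U}), cancel f g /\ cancel g f.
Proof.
move=> [f [g fK gK]].
have lg : linear g by move=> a u v; apply: (can_inj fK); rewrite linearP !gK.
by exists f, (mklin lg).
Qed.

Lemma isomorphic_sym U V : isomorphic U V -> isomorphic V U.
Proof. by move=> /isomorphic_inv[f [g [fK gK]]]; exists g, f. Qed.

Lemma lin_lift U V W (f : {linear U -> V}) (j : {linear W -> V}) :
  injective j -> (forall u, exists w, j w = f u) ->
  exists g : {linear U -> W}, forall u, j (g u) = f u.
Proof.
move=> ji fj; have [|||g gP] := @linear_of_graph U W (fun u w => j w = f u).
- by [].
- by move=> a u v u' v' e e'; rewrite !linearP e e'.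
- by move=> v; rewrite raddf0 => e; apply: ji; rewrite raddf0.
by exists g => u; apply/gP.
Qed.

Lemma lin_factor U V W (f : {linear U -> V}) (p : {linear U -> W}) :
  surjective p -> (forall u, p u = 0 -> f u = 0) ->
  exists g : {linear W -> V}, forall u, g (p u) = f u.
Proof.
move=> ps pf.
have [|||g gP] := @linear_of_graph W V (fun w v => exists2 u, p u = w & f u = v).
- by move=> w; have [u <-] := ps w; exists (f u), u.
- move=> a ? ? ? ? [u <- <-] [u' <- <-].
  by exists (a *: u + u'); rewrite linearP.
- by move=> v [u /pf-> ->].
by exists g => u; apply/gP; exists u.
Qed.

End LinearMaps.

(** * Vanishing of Ext in the first variable *)

Section ExtVanishing.
Variable R : comNzRingType.
Implicit Types A B C E F X Y K P Q N : lmodType R.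

(** This is Ext^1(X, N) = 0 read as surjectivity of Hom(B, N) -> Hom(A, N). Ranging over all
    extensions of X, not one presentation, makes pullback arguments direct; [ext1_of_presentation]
    recovers it from a single presentation. *)
Definition ext1_zero X N :=
  forall A B (i : {linear A -> B}) (p : {linear B -> X}), ses i p ->
  forall h : {linear A -> N}, exists H : {linear B -> N}, forall a, H (i a) = h a.

(* [ext_zero n X N] stands for Ext^(n+1)(X, N) = 0: note the shift by one. *)
Fixpoint ext_zero (n : nat) X N : Prop :=
  if n is n'.+1 then
    exists K P (i : {linear K -> P}) (p : {linear P -> X}),
      [/\ projective_module P, ses i p & ext_zero n' K N]
  else ext1_zero X N.

Lemma proj_split A B P (i : {linear A -> B}) (p : {linear B -> P}) :
  ses i p -> projective_module P ->
  exists2 s : {linear P -> B}, forall x, p (s x) = x &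
    exists r : {linear B -> A}, forall b, i (r b) = b - s (p b).
Proof.
move=> [ii ex ps] prP.
have [s sP] := prP _ _ p idfun ps.
exists s => //; have [|r rP] := lin_lift (f := idfun \- (s \o p)) ii; last by exists r.
by move=> b; apply/ex; rewrite /= linearB sP subrr.
Qed.

Lemma ext1_proj P N : projective_module P -> ext1_zero P N.
Proof.
move=> prP A B i p sip h.
have [s sP [r rP]] := proj_split sip prP; have [ii ex ps] := sip.
exists (h \o r) => a /=; congr (h _); apply: ii.
have pia : p (i a) = 0 by apply/ex; exists a.
by rewrite rP pia raddf0 subr0.
Qed.

(* The extension over an arbitrary B is H' + h on P and A, glued along a lift
   of P -> X to B. *)
Lemma ext1_of_presentation X N K P (i : {linear K -> P}) (p : {linear P -> X}) :
  ses i p -> projective_module P ->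
  (forall h : {linear K -> N}, exists H : {linear P -> N}, forall k, H (i k) = h k) ->
  ext1_zero X N.
Proof.
move=> [ii iex ps] prP ext A B j q [ji jex qs] h.
have [l lP] := prP _ _ q p qs.
have [|l' l'P] := @lin_lift _ _ _ _ (l \o i : {linear K -> B}) j ji.
  by move=> k; apply/jex; rewrite /= lP; apply/iex; exists k.
have [H HP] := ext (h \o l').
have [|b|H' H'P] := @lin_factor _ _ N _ (copair_lin h H)
  (copair_lin j l : {linear (A * P)%type -> B}).
- move=> b; have [x xP] := ps (q b).
  have /jex[a aP] : q (b - l x) = 0 by rewrite linearB lP xP subrr.
  by exists (a, x); rewrite /= aP subrK.
- case: b => a x /= e.
  have /iex[k kx] : p x = 0.
    have qja : q (j a) = 0 by apply/jex; exists a.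
    by rewrite -lP -[LHS]add0r -qja -linearD e raddf0.
  have ak : a = - l' k.
    by apply: ji; rewrite linearN l'P /= kx; apply/eqP; rewrite -addr_eq0 e.
  by rewrite ak -kx HP linearN /= addNr.
exists H' => a; have := H'P (a, 0).
by rewrite /= !raddf0 !addr0.
Qed.

(** Pull the extension back along [r] to an extension of Y, namely the kernel of [D], and extend [h]
    there. Then restrict to B through b |-> (b, s (p b)), which lands in the pullback because r s =
    1. *)
Lemma ext1_retract X Y N (s : {linear X -> Y}) (r : {linear Y -> X}) :
  (forall x, r (s x) = x) -> ext1_zero Y N -> ext1_zero X N.
Proof.
move=> rs extY A B i p [ii iex ps] h.
pose D : {linear (B * Y)%type -> X} := copair_lin p (\- r).
have DE u : D u = p u.1 - r u.2 by [].
have [|iD iDP] := @lin_lift _ _ _ _ (pair_lin i \0 : {linear A -> (B * Y)%type})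
  _ (@subincl_inj _ _ (kermod D)).
  move=> a; have pia : p (i a) = 0 by apply/iex; exists a.
  have k : (i a, 0) \in (kermod D : submodClosed _).
    by apply/eqP; rewrite DE /= pia raddf0 subrr.
  by exists (Submod k).
have [|H HP] := extY _ _ iD (snd \o subincl (kermod D)) _ h.
  split.
  - move=> a b e; apply: ii; have := iDP a; rewrite e iDP.
    by move=> [].
  - move=> [[b y] ku]; split=> /= [y0|[a e]]; last first.
      by have := iDP a; rewrite e => -[].
    have pb0 : p b = 0.
      by have := (kermodP _ _).1 ku; rewrite DE /= y0 raddf0 subr0.
    have [a ab] := (iex _).1 pb0.
    by exists a; apply: subincl_inj; rewrite iDP /= ab y0.
  - move=> y; have [b bP] := ps (r y).
    have k : (b, y) \in (kermod D : submodClosed _).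
      by apply/eqP; rewrite DE /= bP subrr.
    by exists (Submod k).
have [|sD sDP] := @lin_lift _ _ _ _
  (pair_lin idfun (s \o p) : {linear B -> (B * Y)%type}) _ (@subincl_inj _ _ (kermod D)).
  move=> b; have k : (b, s (p b)) \in (kermod D : submodClosed _).
    by apply/eqP; rewrite DE /= rs subrr.
  by exists (Submod k).
exists (H \o sD) => a; rewrite /= -HP; congr (H _); apply: subincl_inj.
have pia : p (i a) = 0 by apply/iex; exists a.
by rewrite sDP iDP /= pia raddf0.
Qed.

Lemma ses_comp_ker A B C E (f : {linear A -> B}) (g : {linear B -> C})
    (p : {linear E -> B}) : ses f g -> surjective p ->
  exists (q : {linear submod (kermod (g \o p)) -> A}),
    surjective q /\ forall u, f (q u) = p (subincl _ u).
Proof.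
move=> [fi fex gs] ps.
have [|q qP] := @lin_lift _ _ _ _ (p \o subincl (kermod (g \o p))) f fi.
  by move=> [u /= /eqP ku]; apply/fex.
exists q; split=> // a; have [x xP] := ps (f a).
have k : x \in (kermod (g \o p) : submodClosed E).
  by apply/eqP; rewrite /= xP; apply/fex; exists a.
by exists (Submod k); apply: fi; rewrite qP.
Qed.

(** The kernel of g p is the preimage of A in E, an extension of A by K. It splits an extension of B
    into two successive ones, and is a syzygy of C when E is projective. *)
Lemma ses_ker_comp A B C K E (f : {linear A -> B}) (g : {linear B -> C})
    (i : {linear K -> E}) (p : {linear E -> B}) : ses f g -> ses i p ->
  exists (j : {linear K -> submod (kermod (g \o p))})
    (q : {linear submod (kermod (g \o p)) -> A}),
    [/\ ses j q, forall u, f (q u) = p (subincl _ u) & forall k, subincl _ (j k) = i k].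
Proof.
move=> sfg [ii iex ps]; have [q [qs qP]] := ses_comp_ker sfg ps.
have [fi fex gs] := sfg.
have [|j jP] := @lin_lift _ _ _ _ i _ (@subincl_inj _ _ (kermod (g \o p))).
  move=> k; have pik : p (i k) = 0 by apply/iex; exists k.
  have kk : i k \in (kermod (g \o p) : submodClosed E).
    by apply/eqP; rewrite /= pik raddf0.
  by exists (Submod kk).
exists j, q; split=> //; split=> //.
  by move=> u v e; apply: ii; rewrite -!jP e.
move=> v; split=> [qv|[k <-]].
  have /iex[k kP] : p (subincl _ v) = 0 by rewrite -qP qv raddf0.
  by exists k; apply: subincl_inj; rewrite jP.
by apply: fi; rewrite qP jP raddf0; apply/iex; exists k.
Qed.

(** Extend [h] first from K to the preimage of A, then from there to E, whose quotient by that
    preimage is C. *)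
Lemma ext1_mid A B C N (f : {linear A -> B}) (g : {linear B -> C}) :
  ses f g -> ext1_zero A N -> ext1_zero C N -> ext1_zero B N.
Proof.
move=> sfg extA extC K E i p sip h.
have [j [q [sjq qP jP]]] := ses_ker_comp sfg sip.
have [H HP] := extA _ _ _ _ sjq h.
have [fi fex gs] := sfg; have [ii iex ps] := sip.
have sgp : surjective (g \o p).
  by move=> c; have [b <-] := gs c; have [x <-] := ps b; exists x.
have [H' H'P] := extC _ _ _ _ (ses_ker sgp) H.
by exists H' => k; rewrite -jP H'P HP.
Qed.

Lemma free_cover X : exists K P (i : {linear K -> P}) (p : {linear P -> X}),
  projective_module P /\ ses i p.
Proof.
do 4 eexists; split; first exact: (@free_mod_proj _ X).
exact: ses_ker (@free_aug_surj _ X).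
Qed.

Lemma proj_prod P Q : projective_module P -> projective_module Q ->
  projective_module (P * Q)%type.
Proof.
move=> prP prQ A B g f gs.
have [h hP] := prP _ _ g (f \o pair_lin idfun \0) gs.
have [k kP] := prQ _ _ g (f \o pair_lin \0 idfun) gs.
exists (copair_lin h k) => -[x y].
rewrite linearD hP kP /= -linearD; apply: (congr1 f).
by apply: injective_projections; rewrite /= ?addr0 ?add0r.
Qed.

(* The one-step horseshoe. *)
Lemma ext_zero_mid n A B C N (f : {linear A -> B}) (g : {linear B -> C}) :
  ses f g -> ext_zero n A N -> ext_zero n C N -> ext_zero n B N.
Proof.
elim: n A B C f g => [|n IHn] A B C f g sfg; first exact: ext1_mid sfg.
move=> [K [P [i [p [prP sip exK]]]]] [K' [P' [i' [p' [prP' sip' exK']]]]].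
have [fi fex gs] := sfg; have [ii iex ps] := sip; have [ii' iex' ps'] := sip'.
have [l lP] := prP' _ _ g p' gs.
pose e : {linear (P * P')%type -> B} := copair_lin (f \o p) l.
have gf a : g (f a) = 0 by apply/fex; exists a.
have es : surjective e.
  move=> b; have [x' x'P] := ps' (g b).
  have /fex[a aP] : g (b - l x') = 0 by rewrite linearB lP x'P subrr.
  by have [x xP] := ps a; exists (x, x'); rewrite /= xP aP subrK.
exists (submod (kermod e)), (P * P')%type, (subincl _), e; split.
- exact: proj_prod.
- exact: ses_ker.
have [|j jP] := @lin_lift _ _ _ _ (pair_lin i \0 : {linear K -> (P * P')%type}) _
  (@subincl_inj _ _ (kermod e)).
  move=> k; have pik : p (i k) = 0 by apply/iex; exists k.
  have kk : (i k, 0) \in (kermod e : submodClosed _).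
    by apply/eqP; rewrite /= pik !raddf0 addr0.
  by exists (Submod kk).
have [|q qP] := @lin_lift _ _ _ _ (snd \o subincl (kermod e)) _ ii'.
  move=> [[x x'] /= /eqP ke]; apply/iex'; rewrite -lP.
  by have := congr1 g ke; rewrite /= linearD gf add0r raddf0.
apply: (IHn _ _ _ j q _ exK exK'); split.
- by move=> u v uv; apply: ii; have := jP u; rewrite uv jP => -[].
- move=> u; split=> [qu|[k ku]]; last first.
    have iq : i' (q u) = 0 by rewrite qP -ku; have := congr1 snd (jP k).
    by apply: ii'; rewrite iq raddf0.
  have := qP u; rewrite qu raddf0.
  case: u qu => [[x x'] ku] qu /= x'0.
  have /iex[k kx] : p x = 0.
    apply: fi; rewrite raddf0.
    by have := (kermodP _ _).1 ku; rewrite /= -x'0 raddf0 addr0.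
  by exists k; apply: subincl_inj; rewrite jP /= kx x'0.
- move=> k'; have /fex[a aP] : g (- l (i' k')) = 0.
    by rewrite linearN lP (iex' (i' k')).2 ?oppr0 //; exists k'.
  have [x xP] := ps a.
  have ku : (x, i' k') \in (kermod e : submodClosed _).
    by apply/eqP; rewrite /= xP aP addNr.
  by exists (Submod ku); apply: ii'; rewrite qP.
Qed.

Lemma ext_zero_trivial n X N : zero_module X -> ext_zero n X N.
Proof.
elim: n X => [|n IHn] X X0.
  move=> A B i p [ii iex ps] h.
  have bij b : exists a, i a = b by apply/iex; apply: X0.
  have [r rP] := lin_lift (f := idfun) ii bij.
  by exists (h \o r) => a /=; congr (h _); apply: ii; rewrite rP.
exists X, X, idfun, idfun; split; last exact: IHn.
- move=> A B g f gs; exists \0 => x /=.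
  by rewrite (X0 x) !raddf0.
- split; first by [].
  + by move=> v; split=> [_|_]; [exists v | apply: X0].
  + by move=> v; exists v.
Qed.

Lemma ext_zero_proj n P N : projective_module P -> ext_zero n P N.
Proof.
move=> prP; case: n => [|n]; first exact: ext1_proj.
pose i : {linear P -> P} := idfun.
have si : surjective i by move=> v; exists v.
exists (submod (kermod i)), P, (subincl _), i; split=> //; first exact: ses_ker.
by apply: ext_zero_trivial => -[v kv]; apply: subincl_inj; apply/eqP: kv.
Qed.

Lemma ext_zero_proj_ext n A B P N (f : {linear A -> B}) (g : {linear B -> P}) :
  ses f g -> projective_module P -> ext_zero n A N -> ext_zero n B N.
Proof. by move=> sfg prP exA; apply: ext_zero_mid sfg exA _; apply: ext_zero_proj. Qed.

(** The sequence splits, so degree one is the retract case. In higher degrees a cover F -> B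
    followed by the retraction covers A, and its kernel is an extension of P by the kernel K of F ->
    B. *)
Lemma ext_zero_proj_sub n A B P N (f : {linear A -> B}) (g : {linear B -> P}) :
  ses f g -> projective_module P -> ext_zero n B N -> ext_zero n A N.
Proof.
move=> sfg prP; have [s sP [r rP]] := proj_split sfg prP.
have [fi fex gs] := sfg.
have gf a : g (f a) = 0 by apply/fex; exists a.
have rf a : r (f a) = a by apply: fi; rewrite rP gf raddf0 subr0.
case: n => [|n]; first exact: ext1_retract rf.
move=> [K [F [i [p [prF sip exK]]]]].
have [ii iex ps] := sip.
have rs : surjective r by move=> a; exists (f a).
have srp : surjective (r \o p).
  by move=> a; have [b <-] := rs a; have [x <-] := ps b; exists x.
exists (submod (kermod (r \o p))), F, (subincl _), (r \o p); split=> //; first exact: ses_ker.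
have rs0 x : r (s x) = 0 by apply: fi; rewrite rP sP subrr raddf0.
have ssr : ses s r.
  split=> //; first by move=> x y e; rewrite -(sP x) e sP.
  move=> b; split=> [rb|[x <-]//]; exists (g b).
  by have := rP b; rewrite rb raddf0 => /esym/eqP; rewrite subr_eq0 => /eqP.
have [j [q [sjq _ _]]] := ses_ker_comp ssr sip.
exact: ext_zero_proj_ext sjq prP exK.
Qed.

(* Schanuel's lemma: both kernels are, up to a projective, the fibre product. *)
Lemma ext_zero_syzygy n X N K P (i : {linear K -> P}) (p : {linear P -> X}) :
  projective_module P -> ses i p -> ext_zero n.+1 X N -> ext_zero n K N.
Proof.
move=> prP sip [K' [P' [i' [p' [prP' sip' exK']]]]].
pose D : {linear (P * P')%type -> X} := copair_lin p (\- p').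
have DE u : D u = p u.1 - p' u.2 by [].
(* The fibre product enters only through its two projections, so one argument serves both: each
   projection is onto, with kernel that of the opposite map to X. *)
have fib (K1 P1 P2 : lmodType R) (i1 : {linear K1 -> P1}) (p1 : {linear P1 -> X})
   (p2 : {linear P2 -> X}) (Q : lmodType R) (a : {linear Q -> P1}) (b : {linear Q -> P2}) :
   ses i1 p1 -> surjective p2 -> (forall x y, p1 x = p2 y <-> exists u, a u = x /\ b u = y) ->
   (forall u v, a u = a v -> b u = b v -> u = v) ->
   exists j : {linear K1 -> Q}, ses j b.
  move=> [ii1 iex1 ps1] ps2 pb inj.
  have abi : injective (pair_lin a b) by move=> u v [au bu]; apply: inj.
  have [|j jP] := lin_lift (f := pair_lin i1 \0 : {linear K1 -> (P1 * P2)%type}) abi.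
    move=> k; have pik : p1 (i1 k) = 0 by apply/iex1; exists k.
    have [|u [au bu]] := (pb (i1 k) 0).1; first by rewrite pik raddf0.
    by exists u; rewrite /= au bu.
  exists j; split.
  - by move=> u v uv; apply: ii1; have := jP u; rewrite uv jP => -[].
  - move=> u; split=> [bu|[k <-]]; last by have [] := jP k.
    have /iex1[k kP] : p1 (a u) = 0.
      by rewrite ((pb (a u) (b u)).2 _) ?bu ?raddf0 //; exists u.
    by exists k; apply: abi; rewrite jP /= kP bu.
  - by move=> y; have [x xP] := ps1 (p2 y); have [u [_ <-]] := (pb x y).1 xP; exists u.
have [ii iex ps] := sip; have [ii' iex' ps'] := sip'.
pose a := fst \o subincl (kermod D); pose b := snd \o subincl (kermod D).
have pb x y : p x = p' y <-> exists u, a u = x /\ b u = y.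
  split=> [e|[[[x1 y1] /= ku] [<- <-]]]; last first.
    by apply/eqP; rewrite -subr_eq0; apply: ku.
  have ku : (x, y) \in (kermod D : submodClosed _) by rewrite unfold_in DE /= e subrr.
  by exists (Submod ku).
have inj u v : a u = a v -> b u = b v -> u = v.
  by move=> au bu; apply: subincl_inj; apply: injective_projections.
have [j sj] := fib _ _ _ _ _ _ _ a b sip ps' pb inj.
have [||j' sj'] := fib _ _ _ _ _ _ _ b a sip' ps.
- move=> x y; split=> [e|[u [ux uy]]].
    by have [u [uy ux]] := (pb y x).1 (esym e); exists u.
  by apply/esym/(pb y x).2; exists u.
- by move=> u v bu au; apply: inj.
apply: (ext_zero_proj_sub sj prP').
exact: (ext_zero_proj_ext sj' prP).
Qed.

(** A piece of the long exact sequence: the kernel of P -> B -> C is a syzygy of C and an extension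
    of A by a syzygy of B. *)
Lemma ext_zero_coker n A B C N (f : {linear A -> B}) (g : {linear B -> C}) :
  ses f g -> ext_zero n A N -> ext_zero n.+1 B N -> ext_zero n.+1 C N.
Proof.
move=> sfg exA [K [P [i [p [prP sip exK]]]]].
have [j [q [sjq _ _]]] := ses_ker_comp sfg sip.
have [fi fex gs] := sfg; have [ii iex ps] := sip.
have sgp : surjective (g \o p).
  by move=> c; have [b <-] := gs c; have [x <-] := ps b; exists x.
exists (submod (kermod (g \o p))), P, (subincl _), (g \o p); split=> //.
  exact: ses_ker.
exact: ext_zero_mid sjq exK exA.
Qed.

Lemma ext_zero_iso n X Y N : isomorphic X Y -> ext_zero n X N -> ext_zero n Y N.
Proof.
move=> [f [f' fK f'K]].
case: n => [|n].
  have lf' : linear f'.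
    by move=> a u v; apply: (can_inj fK); rewrite linearP !f'K.
  exact: (@ext1_retract _ _ _ (mklin lf') f).
move=> [K [P [i [p [prP [ii iex ps] exK]]]]].
exists K, P, i, (f \o p); split=> //; split=> //.
- move=> x; split=> /= [fpx|/iex px]; last by rewrite px raddf0.
  by apply/iex/(can_inj fK); rewrite fpx raddf0.
- by move=> y; have [x xP] := ps (f' y); exists x; rewrite /= xP f'K.
Qed.

(** The sum of covers of A and B covers the product, with the sum of the two kernels as syzygy;
    induction ends at the retract case. *)
Lemma ext_zero_prodl n A B N : ext_zero n (A * B)%type N -> ext_zero n A N.
Proof.
elim: n A B => [|n IHn] A B.
  exact: (@ext1_retract _ _ _ (pair_lin idfun \0) fst).
have [K [P [i [p [prP sip]]]]] := free_cover A.
have [K' [P' [i' [p' [prP' sip']]]]] := free_cover B.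
move=> exAB; exists K, P, i, p; split=> //; apply: (IHn _ K').
apply: (@ext_zero_syzygy n (A * B)%type N (K * K')%type (P * P')%type
  (pair_lin (i \o fst) (i' \o snd)) (pair_lin (p \o fst) (p' \o snd)) _ _ exAB).
  exact: proj_prod.
have [ii iex ps] := sip; have [ii' iex' ps'] := sip'.
split.
- by move=> [x x'] [y y'] [/ii-> /ii'->].
- move=> [x x']; split=> [[/iex[k <-] /iex'[k' <-]]|[[k k'] [<- <-]]].
    by exists (k, k').
  by congr pair; [apply/iex; exists k | apply/iex'; exists k'].
- by move=> [x x']; have [y <-] := ps x; have [y' <-] := ps' x'; exists (y, y').
Qed.

End ExtVanishing.

(** * Vanishing of Ext in the second variable *)

Section SecondVariable.
Variable R : comNzRingType.
Implicit Types A B C E F X Y K P Q N Z : lmodType R.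

Lemma ext1_target_retract X N N' (s : {linear N' -> N}) (r : {linear N -> N'}) :
  (forall x, r (s x) = x) -> ext1_zero X N -> ext1_zero X N'.
Proof.
move=> rs ext A B i p sip h; have [H HP] := ext _ _ _ _ sip (s \o h).
by exists (r \o H) => a /=; rewrite HP /= rs.
Qed.

Lemma ext_zero_target_retract n X N N' (s : {linear N' -> N}) (r : {linear N -> N'}) :
  (forall x, r (s x) = x) -> ext_zero n X N -> ext_zero n X N'.
Proof.
move=> rs; elim: n X => [|n IHn] X; first exact: ext1_target_retract rs.
by move=> [K [P [i [p [prP sip /IHn exK]]]]]; exists K, P, i, p.
Qed.

(** The pullback of N -> N'' along [h] is an extension of K by N'. Extending the identity of N' to
    it splits it; subtracting this from the projection to N leaves a map that kills N' and descends
    to the lift. *)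
Lemma ext1_hom_lift K N' N N'' (f : {linear N' -> N}) (g : {linear N -> N''}) :
  ses f g -> ext1_zero K N' -> forall h : {linear K -> N''},
  exists h' : {linear K -> N}, forall k, g (h' k) = h k.
Proof.
move=> [fi fex gs] ext h.
pose D : {linear (N * K)%type -> N''} := copair_lin g (\- h).
have DE u : D u = g u.1 - h u.2 by [].
have gf x : g (f x) = 0 by apply/fex; exists x.
have [|j jP] := @lin_lift _ _ _ _ (pair_lin f \0 : {linear N' -> (N * K)%type}) _
  (@subincl_inj _ _ (kermod D)).
  move=> x; have k : (f x, 0) \in (kermod D : submodClosed _).
    by apply/eqP; rewrite DE /= gf raddf0 subrr.
  by exists (Submod k).
have sj : ses j (snd \o subincl (kermod D)).
  split.
  - by move=> u v uv; apply: fi; have := jP u; rewrite uv jP => -[].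
  - move=> [[b y] ku]; split=> /= [y0|[a e]]; last first.
      by have := jP a; rewrite e => -[].
    have gb0 : g b = 0.
      by have := (kermodP _ _).1 ku; rewrite DE /= y0 raddf0 subr0.
    have [a ab] := (fex _).1 gb0.
    by exists a; apply: subincl_inj; rewrite jP /= ab y0.
  - move=> y; have [b bP] := gs (h y).
    have k : (b, y) \in (kermod D : submodClosed _).
      by apply/eqP; rewrite DE /= bP subrr.
    by exists (Submod k).
have [H HP] := ext _ _ _ _ sj idfun.
pose t : {linear submod (kermod D) -> N} := (fst \o subincl (kermod D)) \- (f \o H).
have [_ _ ps] := sj.
have [u /= pu|h' h'P] := lin_factor (f := t) ps.
  have [a au] : exists a, j a = u.
    by have [_ ex _] := sj; apply/ex.
  by rewrite /t /= -au HP; have := congr1 fst (jP a) => /= ->; rewrite subrr.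
exists h' => y; have [u uy] := ps y.
rewrite -uy h'P /t /= linearB gf subr0.
have := (kermodP D _).1 (submodP u); rewrite DE => /eqP.
by rewrite subr_eq0 => /eqP.
Qed.

(** In lowest degree, a map from the syzygy K to N'' lifts to N because Ext^1(K, N') = 0, and the
    lift extends to P because Ext^1(X, N) = 0. Higher degrees reduce to this by passing to syzygies
    of X. *)
Lemma ext_zero_target_coker n X N' N N'' (f : {linear N' -> N}) (g : {linear N -> N''}) :
  ses f g -> ext_zero n X N -> ext_zero n.+1 X N' -> ext_zero n X N''.
Proof.
move=> sfg; elim: n X => [|n IHn] X.
  move=> exN [K [P [i [p [prP sip exK]]]]].
  apply: (ext1_of_presentation sip prP) => h.
  have [h' h'P] := ext1_hom_lift sfg exK h.
  have [H HP] := exN _ _ _ _ sip h'.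
  by exists (g \o H) => k /=; rewrite HP h'P.
move=> [K [P [i [p [prP sip exK]]]]] exX.
exists K, P, i, p; split=> //; apply: IHn exK _.
exact: ext_zero_syzygy prP sip exX.
Qed.

Lemma ext_zero_cosyzygy n X N E Z (f : {linear N -> E}) (g : {linear E -> Z}) :
  ses f g -> injective_module E -> ext_zero n X Z -> ext_zero n.+1 X N.
Proof.
move=> [fi fex gs] inE; elim: n X => [|n IHn] X; last first.
  by move=> [K [P [i [p [prP sip /IHn exK]]]]]; exists K, P, i, p.
move=> exX; have [K [P [i [p [prP sip]]]]] := free_cover X.
exists K, P, i, p; split=> // A B j q [ji jex qs] h.
(* Extend [h] into E by injectivity. The induced map K -> Z extends to P and lifts back to E;
   subtracting the lift from [H] gives values in N without changing [h] on A. *)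
have [H HP] := inE _ _ j (f \o h) ji.
have [b qb0|h1 h1P] := @lin_factor _ _ _ _ (g \o H) q qs.
  by have [a <-] := (jex b).1 qb0; rewrite /= HP; apply/fex; exists (h a).
have [h2 h2P] := exX _ _ _ _ sip h1.
have [l lP] := prP _ _ g h2 gs.
have [b|r rP] := @lin_lift _ _ _ _ (H \- (l \o i \o q)) f fi.
  by apply/fex; rewrite /= linearB lP h2P h1P /= subrr.
exists r => a; apply: fi; rewrite rP /= HP.
have -> : q (j a) = 0 by apply/jex; exists a.
by rewrite !raddf0 addr0.
Qed.

Lemma ext_zero_of_target_trivial n X N : zero_module N -> ext_zero n X N.
Proof.
move=> N0; elim: n X => [|n IHn] X.
  by move=> A B i p _ h; exists \0 => a; rewrite (N0 (h a)).
have [K [P [i [p [prP sip]]]]] := free_cover X.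
by exists K, P, i, p.
Qed.

(** Dimension shifting along the cosyzygies gives a bound independent of X, from which the
    descending induction on degrees can start. *)
Lemma ext_zero_injdim N : finite_injdim N ->
  exists n0, forall n X, (n0 <= n)%N -> ext_zero n X N.
Proof.
case=> [[E dE aug inE augi ex0 exE]] /= [n0 E0].
(* [k] counts back from place n0 + 1, where the resolution is already zero; each step back costs one
   degree. *)
suff main k : (k <= n0.+1)%N -> forall n X, (k <= n)%N ->
    ext_zero n X (submod (kermod (dE (n0.+1 - k)%N))).
  have [|aug' aug'P] := lin_lift (f := aug) (@subincl_inj _ _ (kermod (dE 0))).
    move=> x; have k : aug x \in (kermod (dE 0) : submodClosed _).
      by apply/eqP/ex0; exists x.
    by exists (Submod k).
  exists n0.+1 => n X le; have := main _ (leqnn _) _ X le.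
  rewrite subnn.
  have [|inv invP] := lin_lift (f := subincl (kermod (dE 0))) augi.
    by move=> [u /= ku]; apply/ex0/eqP.
  by apply: (ext_zero_target_retract (s := aug') (r := inv)) => x; apply: augi; rewrite invP aug'P.
elim: k => [_ n X _|k IHk lek n X].
  apply: ext_zero_of_target_trivial => -[u ku]; apply: subincl_inj => /=.
  by apply: E0; rewrite subn0.
case: n => // n lekn.
have e : (n0.+1 - k = (n0.+1 - k.+1).+1)%N by rewrite subnS prednK ?subn_gt0.
have := IHk (ltnW lek) n X lekn; rewrite e.
set j := (n0.+1 - k.+1)%N.
have [|q qP] := @lin_lift _ _ _ _ (dE j) _ (@subincl_inj _ _ (kermod (dE j.+1))).
  move=> x; have kx : dE j x \in (kermod (dE j.+1) : submodClosed _).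
    by apply/eqP/exE; exists x.
  by exists (Submod kx).
apply: (@ext_zero_cosyzygy _ _ _ _ _ (subincl (kermod (dE j))) q) => //.
split; first exact: subincl_inj.
- move=> v; split=> [qv|[[u ku] <-]].
    have kv : v \in (kermod (dE j) : submodClosed _).
      by apply/eqP; rewrite -qP qv raddf0.
    by exists (Submod kv).
  by apply: subincl_inj; rewrite qP raddf0 /=; apply/eqP.
- move=> [v kv]; have /exE[u uP] := (kermodP _ _).1 kv.
  by exists u; apply: subincl_inj; rewrite qP.
Qed.

Lemma std_ses X n :
  ses (subincl (kermod (free_aug (syzygy X n))) : {linear syzygy X n.+1 -> std_mod X n})
    (free_aug (syzygy X n)).
Proof. exact: ses_ker (@free_aug_surj _ _). Qed.

(** A map on the (n+1)-st syzygy, composed with its free cover, is a cocycle. Being a coboundary, it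
    extends to the free module containing that syzygy, so Ext^1 of the n-th syzygy vanishes. The
    standard short exact sequences carry this back to X. *)
Lemma ext_zero_of_Ext n X N : zero_module (Ext n.+1 X N) -> ext_zero n X N.
Proof.
move=> ext0.
have base : ext1_zero (syzygy X n) N.
  apply: (ext1_of_presentation (std_ses X n) (@free_mod_proj _ _)) => h.
  pose e := free_aug (syzygy X n.+1).
  pose c : Defs.Hom (std_mod X n.+1) N := hom_of_lin (h \o e).
  have cz : c \in (cocycles N (std_resolution X) n.+1).
    apply/eqP; apply: val_inj; apply/funext => x.
    rewrite -[LHS]/(h (e (std_d X n.+1 x))) (_ : e _ = 0) ?raddf0 //.
    by apply/(std_exact (f := e) (fun=> iff_refl _)); exists x.
  have := ext0 (quot_lin _ (Submod cz)); move/quot_lin0.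
  move=> /asboolP[H cH]; exists (lin_of_hom H) => k.
  have [y <-] := free_aug_surj k.
  exact: (congr1 (fun g : Defs.Hom _ _ => submod_val g y) cH).
elim: n base {ext0} => [|n IHn] // base.
suff shift k : (k <= n.+1)%N -> ext_zero k (syzygy X (n.+1 - k)) N.
  by have := shift n.+1; rewrite subnn; apply.
elim: k => [_|k IHk lek]; first by rewrite subn0.
have e : (n.+1 - k = (n.+1 - k.+1).+1)%N by rewrite subnS prednK ?subn_gt0.
have := IHk (ltnW lek); rewrite e => exK.
do 4 eexists; split; first exact: (@free_mod_proj _ (syzygy X (n.+1 - k.+1))).
  exact: std_ses.
exact: exK.
Qed.

(** * Projective resolutions of finite length *)

Lemma zero_resolution X : zero_module X ->
  exists P : proj_resolution X, forall i, zero_module (P i).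
Proof.
move=> X0.
have prX : projective_module X.
  by move=> A B g f gs; exists \0 => x /=; rewrite (X0 x) !raddf0.
have ex : exact_at (\0 : {linear X -> X}) (\0 : {linear X -> X}).
  by move=> v; split=> // _; exists v; rewrite (X0 v).
by exists (@ProjResolution R X (fun=> X) (fun=> \0) \0 (fun=> prX)
  (fun v => ex_intro _ v (esym (X0 v))) ex (fun=> ex)).
Qed.

Section Splice.
Variables (K P X : lmodType R) (i : {linear K -> P}) (p : {linear P -> X}).
Hypotheses (prP : projective_module P) (sip : ses i p) (Q : proj_resolution K).

Definition splice_mod n : lmodType R := if n is n'.+1 then Q n' else P.
Definition splice_d n : {linear splice_mod n.+1 -> splice_mod n} :=
  match n with
  | 0 => i \o pres_aug Q
  | n'.+1 => pres_d Q n'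
  end.

Lemma splice_resolution : exists S : proj_resolution X,
  forall n, (S n.+1 : lmodType R) = Q n.
Proof.
have [ii iex ps] := sip.
have prS n : projective_module (splice_mod n).
  by case: n => //= n; apply: pres_proj.
have ex0 : exact_at (splice_d 0) p.
  move=> v; split=> [/iex[k <-]|[u <-]]; last by apply/iex; exists (pres_aug Q u).
  by have [u <-] := pres_aug_surj Q k; exists u.
have exS n : exact_at (splice_d n.+1) (splice_d n).
  case: n => [|n] v; last exact: pres_exact.
  split=> [iv|/pres_exact0 v0]; last by rewrite /= v0 raddf0.
  by apply/pres_exact0/ii; rewrite -[LHS]/(splice_d 0 v) iv raddf0.
by exists (ProjResolution prS ps ex0 exS).
Qed.

End Splice.

Lemma finite_pd_splice K P X (i : {linear K -> P}) (p : {linear P -> X}) :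
  projective_module P -> ses i p -> finite_pd K -> finite_pd X.
Proof.
move=> prP sip [Q [n Qn]]; have [S SQ] := splice_resolution prP sip Q.
by exists S, n.+1 => -[|k] // lek; rewrite SQ; apply: Qn.
Qed.

Lemma finite_pd_proj P : projective_module P -> finite_pd P.
Proof.
move=> prP; pose j : {linear P -> P} := idfun.
have sj : ses (subincl (kermod j)) j by apply: ses_ker => v; exists v.
apply: finite_pd_splice prP sj _.
have [|Q Q0] := @zero_resolution (submod (kermod j)); last by exists Q, 0.
by move=> [v kv]; apply: subincl_inj; apply/eqP: kv.
Qed.

End SecondVariable.

(** * Noetherian modules *)

Section Noetherian.
Variable R : comNzRingType.
Implicit Types U V N X K P : lmodType R.

(** The span is built one coefficient at a time, so that adding or dropping a generator is a step of
    an induction and needs no indexed sums. *)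
Fixpoint inspan V (s : seq V) (v : V) : Prop :=
  if s is x :: s' then exists a, inspan s' (v - a *: x) else v = 0.

(** Submodules are kept as bare predicates; unlike [idealr], this admits the unit ideal. *)
Definition is_sub V (W : V -> Prop) :=
  W 0 /\ forall a u v, W u -> W v -> W (a *: u + v).

Lemma is_subD V (W : V -> Prop) u v : is_sub W -> W u -> W v -> W (u + v).
Proof. by move=> [_ WP] Wu Wv; rewrite -(scale1r u); apply: WP. Qed.

Lemma is_subZ V (W : V -> Prop) a u : is_sub W -> W u -> W (a *: u).
Proof. by move=> [W0 WP] Wu; rewrite -(addr0 (_ *: _)); apply: WP. Qed.

Lemma is_subB V (W : V -> Prop) u v : is_sub W -> W u -> W v -> W (u - v).
Proof.
move=> sW Wu Wv; apply: (is_subD sW Wu).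
by rewrite -scaleN1r; apply: is_subZ.
Qed.

Lemma inspan_sub V (s : seq V) : is_sub (inspan s).
Proof.
elim: s => [|x s [s0 sP]].
  by split=> // a u v /= -> ->; rewrite scaler0 addr0.
split=> [|a u v [b ub] [c vc]] /=; first by exists 0; rewrite scale0r subr0.
exists (a * b + c); rewrite scalerDl -scalerA opprD addrACA -scalerBr.
exact: sP.
Qed.

Lemma inspan_cons V (s : seq V) x v : inspan s v -> inspan (x :: s) v.
Proof. by exists 0; rewrite scale0r subr0. Qed.

Lemma inspan_head V (s : seq V) x : inspan (x :: s) x.
Proof. by exists 1; rewrite scale1r subrr; have [] := inspan_sub s. Qed.

Lemma inspan_min V (W : V -> Prop) s v :
  is_sub W -> (forall x, x \in s -> W x) -> inspan s v -> W v.
Proof.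
move=> sW; elim: s v => [|x s IHs] v Ws /=; first by move->; have [] := sW.
move=> [a /IHs va]; rewrite -(subrK (a *: x) v); apply: is_subD => //.
  by apply: va => z zs; apply: Ws; rewrite inE zs orbT.
by apply: is_subZ => //; apply: Ws; rewrite inE eqxx.
Qed.

Lemma inspan_mem V (s : seq V) x : x \in s -> inspan s x.
Proof.
elim: s => // y s IHs; rewrite inE => /orP[/eqP->|/IHs]; first exact: inspan_head.
exact: inspan_cons.
Qed.

Lemma inspan_subset V (s t : seq V) v : {subset s <= t} -> inspan s v -> inspan t v.
Proof.
by move=> st; apply: inspan_min; [exact: inspan_sub | move=> x /st; exact: inspan_mem].
Qed.

Lemma inspan_map U V (f : {linear U -> V}) s v : inspan s v -> inspan (map f s) (f v).
Proof.
elim: s v => [|x s IHs] v /=; first by move->; rewrite raddf0.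
by move=> [a /IHs va]; exists a; rewrite -linearZ -linearB.
Qed.

Lemma inspan_sum V (s : seq V) (c : 'I_(size s) -> R) :
  inspan s (\sum_(i < size s) c i *: s`_i).
Proof.
have [s0 sP] := inspan_sub s.
elim/big_ind: _ => [|u v|i _] //; first exact: is_subD (inspan_sub s).
by apply: is_subZ (inspan_sub s) _; apply: inspan_mem; apply: mem_nth.
Qed.

Definition fg V := exists s : seq V, forall v, inspan s v.

Definition noeth V := forall W : V -> Prop, is_sub W ->
  exists s, forall v, W v <-> inspan s v.

Lemma fg_of_fin_gen V : fin_gen V -> fg V.
Proof. by move=> [s sP]; exists s => v; have [c ->] := sP v; apply: inspan_sum. Qed.

Lemma fg_image U V (f : {linear U -> V}) : surjective f -> fg U -> fg V.
Proof.
move=> fs [s sP]; exists (map f s) => v.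
by have [u <-] := fs v; apply: inspan_map.
Qed.

Lemma lift_seq U V (f : U -> V) (s : seq V) :
  (forall x, x \in s -> exists u, f u = x) -> exists t, map f t = s.
Proof.
elim: s => [|x s IHs] fs; first by exists [::].
have [|t <-] := IHs; first by move=> y ys; apply: fs; rewrite inE ys orbT.
by have [|u <-] := fs x; [rewrite inE eqxx | exists (u :: t)].
Qed.

Lemma fg_injective U V (f : {linear U -> V}) : injective f -> noeth V -> fg U.
Proof.
move=> fi nV; have [|s sP] := nV (fun v => exists u, f u = v).
  split=> [|a _ _ [u <-] [v <-]]; first by exists 0; rewrite raddf0.
  by exists (a *: u + v); rewrite linearP.
have [|t ts] := @lift_seq _ _ f s; first by move=> x xs; apply/sP; apply: inspan_mem.
exists t => u; have /sP : exists u', f u' = f u by exists u.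
rewrite -ts; elim: t {ts} u => [|x t IHt] u /=.
  by move=> e; apply: fi; rewrite e raddf0.
by move=> [a]; rewrite -linearZ -linearB => /IHt; exists a.
Qed.

(** For finitely many maps to N that are jointly injective on W, induct on their number: W is
    generated by generators of its intersection with the kernel of the first map and by lifts of
    generators of its image. Evaluation at generators of K makes this apply to Hom(K, N). *)
Lemma noeth_family U N (es : seq {linear U -> N}) (W : U -> Prop) :
  noeth N -> is_sub W ->
  (forall u, W u ->
    (forall i, (i < size es)%N -> nth (\0 : {linear U -> N}) es i u = 0) ->
    u = 0) ->
  exists s, forall u, W u <-> inspan s u.
Proof.
move=> nN; elim: es W => [|e es IHes] W sW W0.
  by exists [::] => u; split=> [Wu|->]; [apply: W0 | have [] := sW].
have [||s sP] := IHes (fun u => W u /\ e u = 0).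
- have [z0 zP] := sW; split; first by rewrite raddf0.
  by move=> a u v [Wu eu] [Wv ev]; split; [apply: zP | rewrite linearP eu ev scaler0 addr0].
- by move=> u [Wu eu] ues; apply: (W0 _ Wu) => -[_|i lti]; [exact: eu | exact: ues].
have [|t tP] := nN (fun x => exists2 u, W u & e u = x).
  split=> [|a _ _ [u Wu <-] [v Wv <-]]; first by exists 0; [have [] := sW | rewrite raddf0].
  by exists (a *: u + v); rewrite ?linearP //; apply: sW.2.
have [t' [t'W t't]] : exists t' : seq U, (forall x, x \in t' -> W x) /\ map e t' = t.
  have : forall x, x \in t -> exists2 u, W u & e u = x.
    by move=> x xt; apply/tP; apply: inspan_mem.
  elim: t {tP} => [|x t IHt] et; first by exists [::].
  have [|t' [t'W <-]] := IHt; first by move=> y ys; apply: et; rewrite inE ys orbT.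
  have [|u Wu <-] := et x; first by rewrite inE eqxx.
  by exists (u :: t'); split=> // y; rewrite inE => /orP[/eqP->|/t'W].
exists (t' ++ s) => u; split=> [Wu|]; last first.
  apply: inspan_min => // x; rewrite mem_cat => /orP[/t'W//|xs].
  by have [] := (sP x).2 (inspan_mem xs).
have : inspan t (e u) by apply/tP; exists u.
rewrite -t't; elim: t' u Wu t'W {t't} => [|x t' IHt] u Wu t'W /=.
  by move=> eu; apply/sP.
move=> [a]; rewrite -linearZ -linearB => h; exists a; apply: IHt h.
- by apply: is_subB => //; apply: is_subZ => //; apply: t'W; rewrite inE eqxx.
- by move=> y yt; apply: t'W; rewrite inE yt orbT.
Qed.

Lemma noeth_ring : noetherian R -> noeth R^o.
Proof.
(* The unit ideal is treated apart, since [noetherian] quantifies over proper ideals only. *)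
move=> nR W sW; have [W1|W1] := pselect (W 1).
  exists [:: 1] => v; split=> _; first by exists v; rewrite /= [X in v - X](mulr1 v) subrr.
  by rewrite -[v](mulr1 v); apply: is_subZ.
pose S : {pred R} := fun x => `[< W x >].
have SP : idealr_closed S.
  split.
  - by apply/asboolP; apply: sW.1.
  - by apply/asboolP.
  - by move=> a u v /asboolP Wu /asboolP Wv; apply/asboolP; apply: sW.2.
pose I : idealr R := HB.pack S (isIdealr.Build R S SP).
have [s sP] := fg_of_fin_gen (nR I).
exists (map (subincl (ideal_mod I)) s) => v; split=> [Wv|].
  have vI : v \in (ideal_mod I : submodClosed R^o) by apply/asboolP.
  by have := inspan_map (subincl _) (sP (Submod vI)).
apply: inspan_min => // x /mapP[[z zI] _ ->] /=.
exact/asboolP/zI.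
Qed.

(** Induct on the generators. The coefficients at x of elements of W form an ideal [J]; lifts of
    generators of [J], together with generators of the part of W in the span of the rest,
    generate. *)
Lemma noeth_fg V : noetherian R -> fg V -> noeth V.
Proof.
move=> /noeth_ring nR [s sP] W sW.
suff [t tP] : exists t, forall v, W v /\ inspan s v <-> inspan t v.
  by exists t => v; rewrite -tP; split=> [|[]].
elim: s {sP} W sW => [|x s IHs] W sW.
  by exists [::] => v; split=> [[]|->] //=; split=> //; apply: sW.1.
have sS := inspan_sub s.
pose J (a : R^o) := exists2 w, W w & inspan s (w - a *: x).
have [|t tP] := nR J.
  split=> [|a u v [w Ww ws] [z Wz zs]].
    by exists 0; [apply: sW.1 | rewrite scale0r subr0; apply: sS.1].
  exists (a *: w + z); first exact: sW.2.
  by rewrite scalerDl -scalerA opprD addrACA -scalerBr; apply: sS.2.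
have [t' [t'W t'P]] : exists t', (forall w, w \in t' -> W w /\ inspan (x :: s) w) /\
    forall a, inspan t a -> exists2 w, inspan t' w & inspan s (w - a *: x).
  have : forall a, a \in t -> J a by move=> a /inspan_mem/tP.
  elim: t {tP} => [|a t IHt] tJ.
    exists [::]; split=> // a ->; exists 0; rewrite // scale0r subr0.
    exact: sS.1.
  have [|t' [t'W t'P]] := IHt; first by move=> b bt; apply: tJ; rewrite inE bt orbT.
  have [|w Ww ws] := tJ a; first by rewrite inE eqxx.
  exists (w :: t'); split=> [y|b].
    by rewrite inE => /orP[/eqP->|/t'W//]; split=> //; exists a.
  move=> [c /t'P[z zt' zs]]; exists (c *: w + z).
    apply: is_subD (inspan_sub _) _ _; last exact: inspan_cons.
    exact: is_subZ (inspan_sub _) (inspan_head _ _).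
  have -> : c *: w + z - b *: x = c *: (w - a *: x) + (z - (b - c *: a) *: x).
    rewrite scalerBl scalerBr opprB scalerA addrACA; congr (_ + _).
    by rewrite addrA addNr add0r.
  exact: sS.2.
have [r rP] := IHs W sW.
have rsub w : w \in r -> W w /\ inspan s w by move=> /inspan_mem/rP.
exists (t' ++ r) => v; split=> [[Wv [a va]]|].
  have [w wt' wa] : exists2 w, inspan t' w & inspan s (w - a *: x).
    by apply/t'P/tP; exists v.
  have Ww : W w by apply: inspan_min wt' => // y /t'W[].
  rewrite -(subrK w v); apply: is_subD (inspan_sub _) _ _.
    apply: (@inspan_subset _ r); first by move=> y yr; rewrite mem_cat yr orbT.
    apply/rP; split; first exact: is_subB.
    have -> : v - w = (v - a *: x) - (w - a *: x) by rewrite opprB addrA subrK.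
    exact: is_subB.
  by apply: inspan_subset wt' => y yt'; rewrite mem_cat yt'.
have gen y : y \in t' ++ r -> W y /\ inspan (x :: s) y.
  by rewrite mem_cat => /orP[/t'W//|/rsub[Wy ys]]; split=> //; apply: inspan_cons.
by split; (apply: inspan_min; [|by move=> y /gen[]|eassumption]) => //; apply: inspan_sub.
Qed.

(** A counterexample would start a strictly increasing chain of counterexamples. The union of the
    chain is finitely generated, hence equal to one of its stages. *)
Lemma noeth_ind V (Q : (V -> Prop) -> Prop) : noeth V ->
  (forall W, is_sub W ->
    (forall W', is_sub W' -> (forall v, W v -> W' v) ->
      (exists2 v, W' v & ~ W v) -> Q W') -> Q W) ->
  forall W, is_sub W -> Q W.
Proof.
move=> nV step W0 sW0; apply: contrapT => nQ.
pose T := {W : V -> Prop | is_sub W /\ ~ Q W}.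
have next (t : T) : exists t' : T, (forall v, sval t v -> sval t' v) /\
    exists2 v, sval t' v & ~ sval t v.
  case: t => W [sW nW] /=; apply: contrapT => nt; apply/nW/step => // W' sW' WW' ex.
  apply: contrapT => nW'; apply: nt.
  by exists (exist _ W' (conj sW' nW')).
pose f := fix f n : T := if n is n'.+1 then sval (cid (next (f n'))) else
  exist _ W0 (conj sW0 nQ).
have fP n := svalP (cid (next (f n))).
have fle a b v : (a <= b)%N -> sval (f a) v -> sval (f b) v.
  move=> /subnK<-; elim: (b - a)%N => // k IH /IH.
  exact: (fP (k + a)%N).1.
pose U v := exists n, sval (f n) v.
have [|s sP] := nV U.
  split=> [|a u v [n un] [k vk]]; first by exists 0%N; apply: sW0.1.
  exists (maxn n k); apply: (svalP (f (maxn n k))).1.2.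
    by apply: fle un; apply: leq_maxl.
  by apply: fle vk; apply: leq_maxr.
have [n nP] : exists n, forall x, x \in s -> sval (f n) x.
  have : forall x, x \in s -> U x by move=> x /inspan_mem/sP.
  elim: s {sP} => [|x s IHs] sU; first by exists 0%N.
  have [|n nP] := IHs; first by move=> y ys; apply: sU; rewrite inE ys orbT.
  have [|k kP] := sU x; first by rewrite inE eqxx.
  exists (maxn n k) => y; rewrite inE => /orP[/eqP->|/nP].
    exact: fle (leq_maxr _ _) kP.
  by apply: fle; apply: leq_maxl.
have [_ [v v1 v0]] := fP n; apply: v0.
have /sP : U v by exists n.+1.
exact: inspan_min (svalP (f n)).1 nP.
Qed.

End Noetherian.

(** * Local rings and Nakayama's lemma *)

Section LocalRing.
Variables (R : comNzRingType) (m : idealr R).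
Hypothesis loc : noetherian_local m.
Implicit Types U V N X K P F L : lmodType R.

Let nR : noetherian R. Proof. by case: loc. Qed.

(** Noetherian induction takes the place of Zorn's lemma: a proper ideal that is not maximal lies
    strictly inside another proper one. *)
Lemma proper_sub_max (W : R^o -> Prop) : is_sub W -> ~ W 1 -> forall a, W a -> a \in m.
Proof.
move: W; apply: (noeth_ind (noeth_ring nR)) => W sW IH W1.
pose S : {pred R} := fun x => `[< W x >].
have SP : idealr_closed S.
  split.
  - by apply/asboolP; apply: sW.1.
  - by apply/asboolP.
  - by move=> a u v /asboolP Wu /asboolP Wv; apply/asboolP; apply: sW.2.
pose I : idealr R := HB.pack S (isIdealr.Build R S SP).
have [maxI|nmaxI] := pselect (maximal_ideal I).
  by move=> a Wa; have [_ _ /(_ I maxI) <-] := loc; apply/asboolP.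
have [J [IJ [x xJ xI]]] : exists J : idealr R, {subset I <= J} /\ exists2 x, x \in J & x \notin I.
  apply: contrapT => nJ; apply: nmaxI => J IJ x; apply/idP/idP; last exact: IJ.
  by move=> xJ; apply: contrapT => /negP xI; apply: nJ; exists J; split=> //; exists x.
have sJ : is_sub (fun a : R^o => a \in J).
  split; first exact: idealr0.
  by move=> a u v uJ vJ; apply: (@rpredD _ J) => //; apply: idealMr.
have WJ a : W a -> a \in J by move=> Wa; apply: IJ; apply/asboolP.
move=> a /WJ; apply: IH sJ WJ _ _ a.
  by exists x => // Wx; move/negP: xI; apply; apply/asboolP.
by move=> J1; have := idealr1 J; rewrite J1.
Qed.

Lemma notin_max_unit a : a \notin m -> exists b, b * a = 1.
Proof.
move=> /negP am; apply: contrapT => na; apply: am.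
apply: (@proper_sub_max (fun x => exists b, b * a = x)) => //; last by exists 1; rewrite mul1r.
split=> [|c _ _ [b <-] [b' <-]]; first by exists 0; rewrite mul0r.
by exists (c * b + b'); rewrite mulrDl -mulrA.
Qed.

(** Generators modulo U are discarded one at a time. Writing x = y g + u and expanding g with
    coefficient a at x puts (1 - y a) x in the span of U and the other generators, and 1 - y a is a
    unit. *)
Lemma nakayama V (U : V -> Prop) y : y \in m -> fg V -> is_sub U ->
  (forall v, exists g u, U u /\ v = y *: g + u) -> forall v, U v.
Proof.
move=> ym [s sP] sU yU.
have : forall v, exists2 u, U u & inspan s (v - u).
  by move=> v; exists 0; [apply: sU.1 | rewrite subr0].
elim: s {sP} => [|x s IHs] sP v.
  by have [u Uu /eqP] := sP v; rewrite subr_eq0 => /eqP->.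
move: v; apply: IHs.
pose S v := exists2 u, U u & inspan s (v - u).
have sS : is_sub S.
  split=> [|a w z [u Uu us] [t Ut ts]].
    by exists 0; [apply: sU.1 | rewrite subr0; apply: (inspan_sub s).1].
  exists (a *: u + t); first exact: sU.2.
  by rewrite opprD addrACA -scalerBr; apply: (inspan_sub s).2.
have US u : U u -> S u.
  by move=> Uu; exists u; rewrite // subrr; apply: (inspan_sub s).1.
have sSp w : inspan s w -> S w.
  by move=> sw; exists 0; [apply: sU.1 | rewrite subr0].
suff Sx : S x.
  move=> v; have [u Uu [a va]] := sP v.
  rewrite -(subrK u v) -(subrK (a *: x) (v - u)).
  apply: is_subD (US _ Uu) => //; apply: is_subD (sSp _ va) _ => //.
  exact: is_subZ.
have [g [u [Uu xg]]] := yU x; have [u' Uu' [a ga]] := sP g.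
have [|b b1] := @notin_max_unit (1 - y * a).
  apply/negP => ya; have := idealr1 m.
  by rewrite -[1](subrK (y * a)) (@rpredD _ m) // mulrC idealMr.
have xE : (1 - y * a) *: x = y *: ((g - u' - a *: x) + u') + u.
  rewrite scalerBl scale1r {1}xg -scalerA addrAC -scalerBr; congr (y *: _ + _).
  by rewrite addrAC subrK.
rewrite -(scale1r x) -b1 -scalerA xE; apply: is_subZ => //.
apply: is_subD (US _ Uu) => //; apply: is_subZ => //.
by apply: is_subD (US _ Uu') => //; apply: sSp.
Qed.

Lemma fg_hom K N : fg K -> fg N -> fg (Defs.Hom K N).
Proof.
move=> [s sP] fgN.
pose ev (x : K) : {linear Defs.Hom K N -> N} :=
  mklin (fun a (f g : Defs.Hom K N) => erefl : submod_val (a *: f + g) x = _).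
have [||t tP] := @noeth_family R (Defs.Hom K N) N (map ev s) (fun=> True) (noeth_fg nR fgN).
- by [].
- move=> h _ h0; apply: val_inj; apply/funext => x /=.
  apply: (@inspan_min _ _ (fun x => lin_of_hom h x = 0) s) (sP x).
    by split=> [|a u v hu hv]; [rewrite raddf0 | rewrite linearP hu hv scaler0 addr0].
  move=> z zs; have := h0 (index z s); rewrite size_map index_mem => /(_ zs).
  by rewrite (nth_map 0) ?index_mem // nth_index.
by exists t => h; apply/tP.
Qed.

(** * Finite free modules and finitely generated covers *)

Section FreeRow.
Variables (X : lmodType R) (n : nat) (e : 'I_n -> X).

Fact row_comb_subproof : linear (fun v : 'rV[R]_n => \sum_j v 0 j *: e j).
Proof.
move=> a u v; rewrite (eq_bigr (fun j => a *: (u 0 j *: e j) + v 0 j *: e j)).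
  by rewrite big_split -scaler_sumr.
by move=> j _; rewrite !mxE scalerDl scalerA.
Qed.
Definition row_comb : {linear 'rV[R]_n -> X} := mklin row_comb_subproof.

End FreeRow.

Lemma row_linE X n (f : {linear 'rV[R]_n -> X}) v :
  f v = \sum_j v 0 j *: f (delta_mx 0 j).
Proof.
rewrite {1}(row_sum_delta v) linear_sum; apply: eq_bigr => j _.
by rewrite linearZ.
Qed.

Lemma proj_row n : projective_module ('rV[R]_n : lmodType R).
Proof.
move=> A B g f gs; pose a j := sval (cid (gs (f (delta_mx 0 j)))).
exists (row_comb a) => v; rewrite (row_linE f) /= linear_sum; apply: eq_bigr => j _.
by rewrite linearZ /a; case: cid => x /= ->.
Qed.

Lemma row_comb_surj X (s : seq X) : (forall x, inspan s x) ->
  surjective (row_comb (fun j : 'I_(size s) => s`_j)).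
Proof.
set e := row_comb _.
move=> sP x; apply: (@inspan_min _ _ (fun x => exists u, e u = x) s) (sP x).
  split=> [|a _ _ [u <-] [v <-]]; first by exists 0; rewrite raddf0.
  by exists (a *: u + v); rewrite linearP.
move=> z zs; have lt : (index z s < size s)%N by rewrite index_mem.
exists (delta_mx 0 (Ordinal lt)); rewrite /= (bigD1 (Ordinal lt)) //= big1.
  by rewrite mxE !eqxx scale1r addr0 nth_index.
by move=> j jn; rewrite mxE eqxx (negbTE jn) scale0r.
Qed.

Lemma fg_row n : fg ('rV[R]_n : lmodType R).
Proof.
exists [seq delta_mx 0 j | j : 'I_n] => v; rewrite (row_sum_delta v).
have sS := inspan_sub [seq (delta_mx 0 j : 'rV[R]_n) | j : 'I_n].
elim/big_ind: _ => [|u w|j _]; [exact: sS.1 | exact: (is_subD sS) |].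
by apply: is_subZ => //; apply: inspan_mem; apply: image_f.
Qed.

Lemma fg_ker U V (f : {linear U -> V}) : fg U -> fg (submod (kermod f)).
Proof. by move=> /(noeth_fg nR); apply: fg_injective (@subincl_inj _ _ _). Qed.

Lemma fg_cover X : fg X ->
  exists K P (i : {linear K -> P}) (p : {linear P -> X}),
  [/\ projective_module P, fg P, fg K & ses i p].
Proof.
move=> [s sP]; pose e := row_comb (fun j : 'I_(size s) => s`_j).
exists (submod (kermod e)), 'rV[R]_(size s), (subincl (kermod e)), e.
split; [exact: proj_row | exact: fg_row | exact/fg_ker/fg_row |].
exact: ses_ker (row_comb_surj sP).
Qed.

(** A mapping cone construction: P + F covers K + F and hence L, and the resulting first syzygy L'
    of L is presented by K1 and P in the same shape as L by K and F. *)
Lemma scale_pair_syzygy y K F L (j : {linear K -> F}) (p : {linear (K * F)%type -> L}) :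
  projective_module F -> fg K -> ses (pair_lin (scale_lin K y) j) p ->
  exists K1 P (i : {linear K1 -> P}) (q : {linear P -> K}) L'
      (p' : {linear (K1 * P)%type -> L'}),
    [/\ projective_module P, fg K1, ses i q, ses (pair_lin (scale_lin K1 y) (\- i)) p' &
        forall n N, ext_zero n.+1 L N -> ext_zero n L' N].
Proof.
move=> prF fgK [ji jex ps].
have [K1 [P [i [q [prP fgP fgK1 siq]]]]] := fg_cover fgK.
have [ii iex qs] := siq.
pose q' : {linear (P * F)%type -> (K * F)%type} := pair_lin (q \o fst) snd.
have qi k : q (i k) = 0 by apply/iex; exists k.
pose c1 : {linear (K1 * P)%type -> P} := copair_lin i (scale_lin P y).
pose c : {linear (K1 * P)%type -> (P * F)%type} := pair_lin c1 (j \o q \o snd).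
have q's : surjective q'.
  by move=> [k f]; have [x xk] := qs k; exists (x, f); rewrite /= xk.
have pq's : surjective (p \o q').
  by move=> l; have [u <-] := ps l; have [v <-] := q's u; exists v.
have cE u : c u = (i u.1 + y *: u.2, j (q u.2)) by [].
have [|c' c'P] := @lin_lift _ _ _ _ c _ (@subincl_inj _ _ (kermod (p \o q'))).
  move=> u; suff k : c u \in (kermod (p \o q') : submodClosed _) by exists (Submod k).
  apply/kermodP/jex; exists (q u.2).
  by rewrite /= linearD qi add0r linearZ.
exists K1, P, i, q, (submod (kermod (p \o q'))), c'; split=> //; last first.
  move=> n N; apply: (ext_zero_syzygy (i := subincl (kermod (p \o q'))) (p := p \o q')).
    exact: proj_prod.
  exact: ses_ker.
split.
- by move=> u v [_ /oppr_inj/ii].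
- move=> [k x]; split=> [e|[k1 [<- <-]]]; last first.
    apply: subincl_inj; rewrite c'P raddf0 cE.
    apply: injective_projections => /=.
      by rewrite [i _]linearZ scalerN subrr.
    by rewrite linearN qi oppr0 raddf0.
  have := c'P (k, x); rewrite e raddf0 cE => -[/= e1 e2].
  (* Multiplication by [y] and [j] are only jointly injective, so both values at [q x] are needed:
     [e2] gives one, and applying [q] to [e1] the other. *)
  have qx : q x = 0.
    apply: ji; rewrite raddf0 /= -e2; congr pair.
    by rewrite -linearZ -[LHS]add0r -(qi k) -linearD -e1 raddf0.
  have [k1 k1x] := (iex _).1 qx.
  exists (- k1); rewrite /= linearN opprK k1x; congr pair.
  apply: ii; rewrite scalerN linearN [i (_ *: _)]linearZ k1x; apply/eqP.
  by rewrite eq_sym -addr_eq0 -e1.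
- move=> [[x f] kv]; have /jex[k [kx kf]] := (kermodP _ _).1 kv.
  have [x' x'k] := qs k.
  have /iex[k1 k1P] : q (x - y *: x') = 0 by rewrite linearB linearZ x'k /= kx subrr.
  exists (k1, x'); apply: subincl_inj; rewrite c'P cE /= k1P subrK x'k.
  by rewrite -kf.
Qed.

(* The hypothesis makes multiplication by y surjective on Ext^(n+1)(K, N). The
   summand F makes the shape of the sequence stable under passing to syzygies;
   F = 0 is the case of interest. *)
Lemma ext_zero_nakayama_pair n y N : y \in m -> fg N ->
  forall K F L (j : {linear K -> F}) (p : {linear (K * F)%type -> L}),
  projective_module F -> fg K -> ses (pair_lin (scale_lin K y) j) p ->
  ext_zero n.+1 L N -> ext_zero n K N.
Proof.
move=> ym fgN; elim: n => [|n IHn] K F L j p prF fgK sjp exL.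
all: have [K1 [P [i [q [L' [p' [prP fgK1 siq sp' LL']]]]]]] := scale_pair_syzygy prF fgK sjp.
  apply: (ext1_of_presentation siq prP).
  (* The quotient of Hom(K1, N) by [U] is Ext^1(K, N). Extending [h] over K1 + P as (H1, H2) gives h
     = y H1 - H2 i, so Hom(K1, N) = y Hom(K1, N) + [U], and Nakayama applies. *)
  pose U (h : Defs.Hom K1 N) :=
    exists H : {linear P -> N}, forall k, H (i k) = submod_val h k.
  suff UT : forall h, U h.
    by move=> h; have [H HP] := UT (hom_of_lin h); exists H.
  apply: (nakayama ym (fg_hom fgK1 fgN)).
    split=> [|a f g [F1 F1P] [F2 F2P]]; first by exists \0.
    exists ((a \*: F1) \+ F2) => k /=.
    by rewrite F1P F2P.
  move=> h; have [H HP] := LL' _ _ exL _ _ _ _ sp' (lin_of_hom h).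
  pose H1 : {linear K1 -> N} := H \o pair_lin idfun \0.
  pose H2 : {linear P -> N} := H \o pair_lin \0 idfun.
  have HE u : H u = H1 u.1 + H2 u.2.
    rewrite /= -linearD; apply: (congr1 H).
    by apply: injective_projections; rewrite /= ?addr0 ?add0r.
  exists (hom_of_lin H1), (hom_of_lin (\- (H2 \o i))); split.
    by exists (\- H2) => k.
  apply: val_inj; apply/funext => k; rewrite -[LHS]HP HE.
  by rewrite [H1 _]linearZ [H2 _]linearN.
exists K1, P, i, q; split=> //.
exact: IHn prP fgK1 sp' (LL' _ _ exL).
Qed.

Lemma ext_zero_nakayama n y N X L (p : {linear X -> L}) : y \in m -> fg N -> fg X ->
  ses (scale_lin X y) p -> ext_zero n.+1 L N -> ext_zero n X N.
Proof.
move=> ym fgN fgX [ii iex ps].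
(* Rows of length 0 provide the projective module F = 0. *)
pose Z : lmodType R := 'rV[R]_0.
have Z0 (z : Z) : z = 0 by apply/rowP => -[].
apply: (@ext_zero_nakayama_pair n y N ym fgN X Z _ \0 (p \o fst)) => //.
  exact: proj_row.
split.
- by move=> u v [/ii].
- move=> [x z]; split=> [/iex[u ux]|[u [<- _]]]; last by apply/iex; exists u.
  by exists u; apply: injective_projections; [exact: ux | rewrite [RHS]Z0].
- by move=> v; have [x <-] := ps v; exists (x, 0).
Qed.

(** If the first generator x is not in the span of the others, its coefficient is well defined
    modulo m, since a unit coefficient in a relation would make x redundant. This gives a map to k
    with value 1 at x, so x can always be dropped. *)
Lemma zero_of_hom_residue L : fg L ->
  (forall (f : {linear L -> residue m}) x, f x = 0) -> zero_module L.
Proof.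
move=> [s sP] hom0; elim: s sP => [|x s IHs] sP; first by move=> v; apply: sP.
apply: IHs => v; have sS := inspan_sub s.
suff sx : inspan s x.
  have [a va] := sP v; rewrite -(subrK (a *: x) v).
  by apply: is_subD => //; apply: is_subZ.
apply: contrapT => nx.
pose k1 := quot_lin (ideal_mod m).
have k0 a : k1 a = 0 <-> a \in m by rewrite quot_lin0.
have [|||f fP] := @linear_of_graph R L (residue m)
  (fun v c => exists2 a, inspan s (v - a *: x) & c = k1 a).
- by move=> u; have [a ua] := sP u; exists (k1 a), a.
- move=> a u c u' c' [b ub ->] [b' ub' ->]; exists (a *: (b : R^o) + b').
    by rewrite scalerDl -scalerA opprD addrACA -scalerBr; apply: sS.2.
  by rewrite linearP.
- move=> c [a]; rewrite sub0r => ax ->; apply/k0; apply: contrapT => /negP/notin_max_unit[b b1].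
  apply: nx; rewrite -(scale1r x) -b1 -scalerA -(opprK (a *: x)) -scaleN1r.
  by do 2 apply: is_subZ => //.
have : k1 1 = 0.
  by rewrite -(hom0 f x); apply/esym/fP; exists 1; rewrite // scale1r subrr; apply: sS.1.
by move/k0; rewrite idealr1.
Qed.

(** A relation with a unit coefficient removes a generator. Once there is none, the cover is
    minimal, and vanishing of Ext^1(K, k) forces its kernel to be zero. *)
Lemma ext1_residue_proj K : fg K -> ext1_zero K (residue m) -> projective_module K.
Proof.
move=> [s sP] exK; have [n] := ubnP (size s); elim: n s sP => // n IHn s sP sn.
pose e := row_comb (fun j : 'I_(size s) => s`_j).
have es : surjective e := row_comb_surj sP.
have [[v [j [ev vj]]]|em] := pselect (exists v (j : 'I_(size s)), e v = 0 /\ v 0 j \notin m).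
  have [b b1] := notin_max_unit vj.
  apply: (IHn (take j s ++ drop j.+1 s)); last first.
    by rewrite size_cat size_take size_drop ltn_ord -addSn subnKC.
  set t := _ ++ _; have tS := inspan_sub t.
  have tE i : (i < size s)%N -> i != j -> inspan t s`_i.
    move=> lti nij; apply: inspan_mem; rewrite mem_cat.
    have [ltij|] := ltnP i j.
      by rewrite -(nth_take _ ltij) mem_nth // size_take ltn_ord.
    rewrite leq_eqVlt eq_sym (negbTE nij) => /= ltji; apply/orP; right.
    rewrite -(subnKC ltji) -nth_drop mem_nth // size_drop.
    exact: ltn_sub2r (leq_ltn_trans ltji lti) lti.
  move=> x; apply: (inspan_min tS) (sP x) => z zs.
  have lt : (index z s < size s)%N by rewrite index_mem.
  rewrite -(nth_index 0 zs).
  have [->|] := eqVneq (index z s) j; last exact: tE.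
  rewrite -(scale1r (s`_j)) -b1 -scalerA; apply: is_subZ => //.
  move: ev; rewrite /e /= (bigD1 j) //= => /eqP; rewrite addr_eq0 => /eqP->.
  rewrite -sumrN; elim/big_ind: _ => [|u w|i nij]; [exact: tS.1 | exact: (is_subD tS) |].
  by rewrite -scaleNr; apply: is_subZ => //; apply: tE.
have sk := ses_ker es.
(* A map from the kernel to k extends to the free module; the coordinates of every relation lie in
   m, which kills k, so the map is zero. *)
have kz : zero_module (submod (kermod e)).
  apply: zero_of_hom_residue => [|f]; first by apply: fg_ker; apply: fg_row.
  have [H HP] := exK _ _ _ _ sk f => l.
  rewrite -HP row_linE big1 // => j _.
  have lm : (subincl (kermod e) l) 0 j \in m.
    apply: contrapT => /negP lj; apply: em; exists (subincl (kermod e) l), j; split=> //.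
    exact/kermodP/submodP.
  have [c <-] := quot_lin_surj (H (delta_mx 0 j)).
  rewrite -linearZ; apply/quot_lin0.
  suff : (subincl (kermod e) l) 0 j * (c : R) \in m by [].
  by rewrite mulrC; apply: idealMr.
move=> A B g f gs; have [h hP] := proj_row (f \o e) gs.
have [v ev|h' h'P] := lin_factor (f := h) es.
  rewrite -[v]/(subincl (kermod e) (Submod ((kermodP _ _).2 ev))).
  by rewrite (kz (Submod _)) !raddf0.
by exists h' => x; have [v <-] := es x; rewrite h'P hP.
Qed.

Lemma finite_pd_of_ext_residue n X :
  fg X -> ext_zero n X (residue m) -> finite_pd X.
Proof.
elim: n X => [|n IHn] X fgX exX; first exact/finite_pd_proj/ext1_residue_proj.
have [K [P [i [p [prP fgP fgK sip]]]]] := fg_cover fgX.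
apply: (finite_pd_splice prP sip); apply: IHn => //.
exact: ext_zero_syzygy prP sip exX.
Qed.

End LocalRing.

(** * Regular sequences and injective dimension *)

Section RegularSequences.
Variable R : comNzRingType.
Implicit Types V N X C : lmodType R.

Lemma seq_modP (xs : seq R) V (v : V) :
  v \in (@seq_mod R xs V : submodClosed V) <->
  exists u : nat -> V, v = \sum_(i < size xs) xs`_i *: u i.
Proof.
split=> [/asboolP[u ->]|[u ->]]; last by apply/asboolP; exists u.
exists (fun k => if insub k is Some j then u j else 0).
by apply: eq_bigr => i _; rewrite valK.
Qed.

Lemma seq_mod_nil V (v : V) : v \in (@seq_mod R [::] V : submodClosed V) <-> v = 0.
Proof.
rewrite seq_modP; split=> [[u ->]|->]; first by rewrite big_ord0.
by exists (fun=> 0); rewrite big_ord0.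
Qed.

Lemma seq_mod_rcons xs x V (v : V) :
  v \in (@seq_mod R (rcons xs x) V : submodClosed V) <->
  exists u, v - x *: u \in (@seq_mod R xs V : submodClosed V).
Proof.
have sumE (u : nat -> V) : \sum_(i < size (rcons xs x)) (rcons xs x)`_i *: u i =
    \sum_(i < size xs) xs`_i *: u i + x *: u (size xs).
  rewrite size_rcons big_ord_recr /= nth_rcons ltnn eqxx; congr (_ + _).
  by apply: eq_bigr => i _; rewrite nth_rcons ltn_ord.
rewrite seq_modP; split=> [[u ->]|[w /seq_modP[u uP]]].
  by exists (u (size xs)); rewrite sumE addrK; apply/seq_modP; exists u.
pose u' k := if k == size xs then w else u k.
exists u'; rewrite (sumE u') {2}/u' eqxx -(subrK (x *: w) v) uP; congr (_ + _).
by apply: eq_bigr => i _; rewrite /u' (ltn_eqF (ltn_ord i)).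
Qed.

Lemma quot_seq_nil V : isomorphic V (quot_seq [::] V).
Proof.
apply: (isomorphic_bij (f := quot_lin (@seq_mod R [::] V))); last exact: quot_lin_surj.
by apply: lin_inj => v /quot_lin0/seq_mod_nil.
Qed.

Lemma quot_seq_rcons xs x V : injective (scale_lin (quot_seq xs V) x) ->
  exists p : {linear quot_seq xs V -> quot_seq (rcons xs x) V},
    ses (scale_lin (quot_seq xs V) x) p.
Proof.
move=> xi; have qs := @quot_lin_surj R V (@seq_mod R xs V).
have [v /quot_lin0 v0|p pP] :=
  lin_factor (f := quot_lin (@seq_mod R (rcons xs x) V) : {linear V -> _}) qs.
  by apply/quot_lin0/seq_mod_rcons; exists 0; rewrite scaler0 subr0.
exists p; split=> //; last first.
  by move=> y; have [v <-] := quot_lin_surj y; exists (quot_lin (@seq_mod R xs V) v).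
move=> y; have [v <-] := qs y; rewrite pP; split.
  move=> /quot_lin0/seq_mod_rcons[u /quot_lin0 e]; exists (quot_lin (@seq_mod R xs V) u).
  apply/eqP; rewrite eq_sym -subr_eq0; apply/eqP.
  by move: e; rewrite linearB linearZ.
move=> [w]; have [u <-] := qs w => e; apply/quot_lin0/seq_mod_rcons.
by exists u; apply/quot_lin0; rewrite linearB linearZ -e subrr.
Qed.

Definition weakly_regular V (xs : seq R) := forall i, (i < size xs)%N ->
  injective (fun v : quot_seq (take i xs) V => xs`_i *: v).

Lemma quot_seq_take xs V i : weakly_regular V xs -> (i < size xs)%N ->
  exists p : {linear quot_seq (take i xs) V -> quot_seq (take i.+1 xs) V},
    ses (scale_lin (quot_seq (take i xs) V) xs`_i) p.
Proof. by move=> reg lti; rewrite (take_nth 0 lti); apply: quot_seq_rcons; apply: reg. Qed.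

(** In the first variable each division by a regular element raises the bound on the degree by
    one. *)
Lemma ext_zero_quot_seq xs C N n0 : weakly_regular C xs ->
  (forall n, (n0 <= n)%N -> ext_zero n C N) ->
  forall n, (n0 + size xs <= n)%N -> ext_zero n (quot_seq xs C) N.
Proof.
move=> reg exC.
suff main k : (k <= size xs)%N -> forall n, (n0 + k <= n)%N ->
    ext_zero n (quot_seq (take k xs) C) N.
  by move=> n; have := main _ (leqnn _) n; rewrite take_size.
elim: k => [_ n|k IHk ltk [|n]]; rewrite ?addn0 ?addnS //.
  by rewrite take0 => /exC; apply: ext_zero_iso; apply: quot_seq_nil.
rewrite ltnS => len; have [p sp] := quot_seq_take reg ltk.
by apply: (ext_zero_coker sp); apply: IHk (ltnW ltk) _ _ => //; apply: leqW.
Qed.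

(** In the second variable each division removes the top degree of the interval of vanishing; after
    the whole sequence only degree index [a] is left. *)
Lemma ext_zero_target_quot_seq xs C X a : weakly_regular C xs ->
  (forall n, (a <= n <= a + size xs)%N -> ext_zero n X C) ->
  ext_zero a X (quot_seq xs C).
Proof.
move=> reg exC.
suff main k : (k <= size xs)%N -> forall n, (a <= n)%N -> (n + k <= a + size xs)%N ->
    ext_zero n X (quot_seq (take k xs) C).
  by have := main _ (leqnn _) a; rewrite take_size; apply.
elim: k => [_ n lean|k IHk ltk n lean].
  rewrite addn0 take0 => len.
  have [f [g [fK gK]]] := isomorphic_inv (quot_seq_nil C).
  by apply: (ext_zero_target_retract gK); apply: exC; rewrite lean.
rewrite addnS => len; have [p sp] := quot_seq_take reg ltk.
apply: (ext_zero_target_coker sp); apply: IHk (ltnW ltk) _ _ _ => //.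
- exact: ltnW.
- exact: leqW.
Qed.

End RegularSequences.

(** * Ext into a module of finite injective dimension *)

Section InjectiveDimension.
Variables (R : comNzRingType) (m : idealr R).
Hypothesis loc : noetherian_local m.
Implicit Types V N X C : lmodType R.

(** Noetherian induction on the annihilator I of the generator, so that X is R/I. The cases are an
    element of m that is regular on X, an element of m outside I that is a zero divisor on X, and m
    contained in I. *)
Lemma ext_zero_cyclic r N : fg N ->
  (forall X, fg X -> ext_zero r.+1 X N) -> ext_zero r (residue m) N ->
  forall X (v : X), surjective (cyc_lin v) -> ext_zero r X N.
Proof.
move=> fgN exS exk.
suff main I : is_sub I -> forall X (v : X), surjective (cyc_lin v) ->
    (forall a : R^o, a *: v = 0 <-> I a) -> ext_zero r X N.
  move=> X v vs; apply: (main (fun a => a *: v = 0)) vs _ => //.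
  split=> [|a b c bv cv]; first by rewrite scale0r.
  by rewrite scalerDl -scalerA bv cv scaler0 addr0.
move: I; apply: (noeth_ind (noeth_ring (_ : noetherian R))); first by case: loc.
move=> I sI IH X v vs vI.
have fgX : fg X.
  by exists [:: v] => x; have [a <-] := vs x; exists a; rewrite /= subrr.
have [[f [fm fI]]|mI] := pselect (exists f, f \in m /\ ~ I f).
  have [fi|] := pselect (injective (scale_lin X f)).
    apply: (ext_zero_nakayama loc fm fgN fgX (ses_coker fi)); apply: exS.
    exact: fg_image (@quot_lin_surj _ _ _) fgX.
  move=> fni; have [x [fx x0]] : exists x : X, f *: x = 0 /\ x <> 0.
    apply: contrapT => nx; apply: fni; apply: lin_inj => x fx.
    by apply: contrapT => x0; apply: nx; exists x.
  have [a ax] := vs x.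
  (* When f is a zero divisor, X is an extension of R/(I + (f)) by R/(I : f). Both ideals are
     strictly larger than I: the first contains f, the second the element [a] with f a v = 0 and a v
     nonzero. *)
  have sq := ses_quot (immod (cyc_lin (f *: v))).
  apply: (ext_zero_mid sq).
    have wS : f *: v \in (immod (cyc_lin (f *: v)) : submodClosed X).
      by apply/immodP; exists 1; rewrite /= scale1r.
    apply: (IH (fun b => I (b * f)) _ _ _ _ (Submod wS)).
    - split=> [|b c e Ic Ie]; first by rewrite mul0r; apply: sI.1.
      by rewrite mulrDl -mulrA; apply: sI.2.
    - by move=> b Ib; rewrite mulrC; apply: is_subZ.
    - exists a; first by apply/vI; rewrite mulrC -scalerA -[a *: v]/(cyc_lin v a) ax.
      by move/vI => av; apply: x0; rewrite -ax.
    - move=> [u uS]; have /immodP[b bu] := uS.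
      by exists b; apply: subincl_inj.
    - move=> b; rewrite -vI -scalerA; split=> [bv|bv].
        by have := congr1 (subincl _) bv.
      exact: subincl_inj.
  apply: (IH (fun b => exists c, I (b - c * f)) _ _ _ _ (quot_lin _ v)).
  - split=> [|b u w [c Ic] [e Ie]]; first by exists 0; rewrite mul0r subr0; apply: sI.1.
    exists (b * c + e); rewrite mulrDl -mulrA opprD addrACA.
    rewrite -[b * (c * f)]/(b *: (c * f : R^o)) -scalerBr.
    exact: sI.2.
  - by move=> b Ib; exists 0; rewrite mul0r subr0.
  - by exists f => //; exists 1; rewrite mul1r subrr; apply: sI.1.
  - move=> y; have [u <-] := quot_lin_surj y; have [b <-] := vs u.
    by exists b; rewrite -[LHS]linearZ.
  - move=> b; rewrite -linearZ; split=> [/quot_lin0/immodP[c cP]|[c Ic]].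
      exists c; apply/vI; rewrite scalerBl -scalerA -[c *: _]/(cyc_lin (f *: v) c) cP.
      by rewrite subrr.
    apply/quot_lin0/immodP; exists c; apply/esym/eqP.
    by rewrite -subr_eq0 /= scalerA -scalerBl; apply/eqP/vI.
(* Now I contains m, so X is either zero or isomorphic to k. *)
have {}mI f : f \in m -> I f by move=> fm; apply: contrapT => nf; apply: mI; exists f.
have [I1|nI1] := pselect (I 1).
  apply: ext_zero_trivial => x; have [a <-] := vs x.
  by apply/vI; rewrite -[a]mulr1; apply: is_subZ.
have Im a : I a -> a \in m by apply: (proper_sub_max loc sI nI1).
have [a /quot_lin0/mI/vI //|g gP] :=
  lin_factor (f := cyc_lin v) (@quot_lin_surj R R^o (ideal_mod m)).
apply: ext_zero_iso exk; apply: (isomorphic_bij (f := g)).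
  apply: lin_inj => y; have [a <-] := quot_lin_surj y.
  by rewrite gP => /vI/Im am; apply/quot_lin0.
by move=> x; have [a <-] := vs x; exists (quot_lin _ a).
Qed.

Lemma ext_zero_of_cyclic r N :
  (forall X (v : X), surjective (cyc_lin v) -> ext_zero r X N) ->
  forall X, fg X -> ext_zero r X N.
Proof.
move=> exc X [s]; move: {2}(size s) (erefl (size s)) => n.
elim: n X s => [|n IHn] X [|x s] //= sz sP; first exact: ext_zero_trivial.
apply: (ext_zero_mid (ses_quot (immod (cyc_lin x)))).
  have xS : x \in (immod (cyc_lin x) : submodClosed X).
    by apply/immodP; exists 1; rewrite /= scale1r.
  apply: (exc _ (Submod xS)) => -[u uS]; have /immodP[b bu] := uS.
  by exists b; apply: subincl_inj.
have px : quot_lin (immod (cyc_lin x)) x = 0.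
  by apply/quot_lin0/immodP; exists 1; rewrite /= scale1r.
pose p := quot_lin (immod (cyc_lin x)).
apply: (IHn _ (map p s)); first by rewrite size_map; case: sz.
move=> y; have [v <-] := quot_lin_surj y; have [a /(inspan_map p)] := sP v.
by rewrite linearB linearZ [p x]px raddf0 subr0.
Qed.

Lemma proj_ring : projective_module R^o.
Proof.
move=> A B g f gs; have [x xP] := gs (f 1).
by exists (cyc_lin x) => a; rewrite /= linearZ xP -linearZ [a *: _]mulr1.
Qed.

Section Descent.
Variables (N C : lmodType R) (f : {linear R^o -> N}) (g : {linear N -> C}).
Variables (xs ys : seq R) (d : nat).
Hypotheses (fgN : fg N) (sfg : ses f g).
Hypotheses (ysm : {subset ys <= m}) (ys_reg : weakly_regular N ys) (ys_d : size ys = d).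
Hypotheses (xs_reg : weakly_regular C xs) (xs_d : (size xs).+1 = d).
Hypothesis kC : direct_summand (residue m) (quot_seq xs C).

Lemma ext_zero_residue r : (d <= r)%N ->
  (forall n X, (r < n)%N -> fg X -> ext_zero n X N) ->
  forall n, (r <= n)%N -> ext_zero n (residue m) N.
Proof.
move=> ledr exS.
have fgQ k : fg (quot_seq (take k ys) N).
  exact: fg_image (@quot_lin_surj _ _ _) fgN.
(* Begin with N divided by all of [ys]; each element removed from the end of [ys] lowers the bound
   by one, by Nakayama. *)
have exQ k : (k <= d)%N -> forall n, (r < n + k)%N ->
    ext_zero n (quot_seq (take (d - k) ys) N) N.
  elim: k => [_ n|k IHk ltk n]; first by rewrite addn0 => lt; apply: exS.
  rewrite addnS -addSn => len.
  have lt : (d - k.+1 < size ys)%N by rewrite ys_d ltn_subrL (leq_ltn_trans _ ltk).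
  have [p sp] := quot_seq_take ys_reg lt.
  apply: (ext_zero_nakayama loc (ysm (mem_nth 0 lt)) fgN (fgQ _) sp).
  rewrite subnSK //; apply: IHk => //; exact: ltnW.
have exN n : (r < n + d)%N -> ext_zero n N N.
  move=> /(exQ _ (leqnn d)); rewrite subnn take0.
  exact/ext_zero_iso/isomorphic_sym/quot_seq_nil.
(* Since d <= r, the index 0 is excluded, so [ext_zero_coker] applies with R projective on the left.
   Dividing C by the d - 1 elements of [xs] then brings the bound to exactly r. *)
have exC n : (r.+1 - d <= n)%N -> ext_zero n C N.
  case: n => [|n]; first by rewrite leqn0 subn_eq0 leqNgt ltnS ledr.
  rewrite leq_subLR addnC => len; apply: (ext_zero_coker sfg) (exN _ len).
  exact/ext_zero_proj/proj_ring.
move=> n len; have [X kX] := kC.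
apply: (@ext_zero_prodl R n (residue m) X); apply: ext_zero_iso (isomorphic_sym kX) _.
apply: (ext_zero_quot_seq xs_reg exC).
by rewrite -xs_d subSS subnK // ltnW // xs_d.
Qed.

(** Descend from the bound given by the injective resolution, where [k] is the number of steps still
    allowed. Each step settles k, then cyclic modules, then all finitely generated ones. *)
Lemma ext_zero_above : finite_injdim N ->
  forall n X, (d <= n)%N -> fg X -> ext_zero n X N.
Proof.
move=> /ext_zero_injdim[n0 ex0].
suff main k r : (d <= r)%N -> (n0 <= r + k)%N ->
    forall n X, (r <= n)%N -> fg X -> ext_zero n X N.
  by apply: (main n0) => //; apply: leq_addl.
elim: k r => [|k IHk] r ledr ler n X len fgX.
  by apply: ex0; apply: leq_trans len; rewrite addn0 in ler.
have exS : forall n X, (r < n)%N -> fg X -> ext_zero n X N.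
  by apply: IHk; [exact: leqW | rewrite addSnnS].
apply: ext_zero_of_cyclic fgX; apply: ext_zero_cyclic fgN _ _ => [Y fgY|].
  by apply: exS fgY; rewrite ltnS.
exact: ext_zero_residue ledr exS _ len.
Qed.

End Descent.

End InjectiveDimension.

(** * From vanishing of Ext(M, R) to finite projective dimension *)

Lemma krull_dim_unique (R : comNzRingType) (M : lmodType R) d d' :
  krull_dim M d -> krull_dim M d' -> d = d'.
Proof.
move=> [[p pM] le] [[p' pM'] le']; apply/eqP; rewrite eqn_leq.
by rewrite (le' _ _ pM) (le _ _ pM').
Qed.

Theorem theorem2p5 (R : comNzRingType) (m : idealr R) (d : nat)
    (omega M : lmodType R) (n : nat) :
  cohen_macaulay_local m ->
  krull_dim R^o%R d -> (0 < d)%N ->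
  canonical_module m omega ->
  condition_star m d omega ->
  fin_gen M ->
  (d + 2 <= n)%N ->
  (forall i, (n <= i <= n + d - 1)%N -> zero_module (Ext i M R^o%R)) ->
  finite_pd M.
Proof.
move=> [loc _] dimR d0 [[cmO [t [dimO dimR']]] _ injO] star /fg_of_fin_gen fgM len ext0.
have [/fg_of_fin_gen fgO [t' [depO dimO']]] := cmO.
(* The depth of omega is its dimension, which is that of R; hence there is an omega-regular sequence
   of length d in m. *)
move: (krull_dim_unique dimO' dimO) (krull_dim_unique dimR' dimR) depO => -> ->.
move=> [[ys [ysd ysm [ys_reg _]]] _].
have [C [f [g [xs [[fi fex gs] _ [xsd xsm] [_ [xs_reg _]] kC]]]]] := star.
have sfg : ses f g by [].
have xsd' : (size xs).+1 = d by rewrite xsd prednK.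
have exO := ext_zero_above loc fgO sfg ysm ys_reg ysd xs_reg xsd' kC injO.
(* One unit is the index shift of [ext_zero], the other the passage from R to C: index [a] for C
   means Ext^(n-1)(M, C). The bound n >= d + 2 becomes a >= d, where Ext into omega vanishes. *)
have [a na] : exists a, n = a.+2.
  by exists (n - 2)%N; rewrite -addn2 subnK // (leq_trans _ len) // leq_addl.
have leda : (d <= a)%N by move: len; rewrite na addn2.
have exC i : (a <= i <= a + size xs)%N -> ext_zero i M C.
  move=> /andP[lai lia]; apply: (ext_zero_target_coker sfg).
    by apply: exO fgM; apply: leq_trans lai.
  apply: ext_zero_of_Ext; apply: ext0.
  by rewrite na -xsd' addnS !addSn subn1 /= !ltnS lai.
apply: (finite_pd_of_ext_residue loc (n := a) fgM).
have [X kX] := kC; have [h [h' [hK h'K]]] := isomorphic_inv kX.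
(* As a direct summand, k is a retract of C/xC, so only Ext^(n-1)(M, C/xC) = 0 remains. *)
apply: (ext_zero_target_retract (s := h \o pair_lin idfun \0) (r := fst \o h')).
  by move=> x; rewrite /= hK.
exact: ext_zero_target_quot_seq xs_reg exC.
Qed.
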